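(* The reduced suspension functor $\Sigma_r : \mathrm{Syn}(\mathsf{MCaTT}) \to \mathrm{Syn}(\mathsf{CaTT})$ is left adjoint to the desuspension functor $\mathrm{D} : \mathrm{Syn}(\mathsf{CaTT}) \to \mathrm{Syn}(\mathsf{MCaTT})$. The counit is given by the family of substitutions $\bullet_\Gamma : \Sigma_r(\mathrm{D}\Gamma) \to \Gamma$, and the unit is a natural family of isomorphisms $\eta_\Gamma : \Gamma \to \mathrm{D}(\Sigma_r \Gamma)$. The adjunction is therefore coreflective.
   Context: $\mathsf{CaTT}$ is the Finster–Mimram dependent type theory for weak $\omega$-categories: types are $\star$ or $\mathrm{Hom}_A\,t\,u$, terms are variables or $\mathsf{op}_{\Gamma,A}[\gamma]$, $\mathsf{coh}_{\Gamma,A}[\gamma]$ indexed by ps-contexts $\Gamma$. $\mathsf{MCaTT}$ is the type theory whose types are a unit type $\mathbb{1}$ (with constant $()$ and an $\eta$-rule making every term of type $\mathbb{1}$ definitionally equal to $()$) or $\mathrm{Hom}_A\,t\,u$ (with $\star$ abbreviating $\mathrm{Hom}_{\mathbb{1}}\,()\,()$), and whose terms are variables, $()$, or $\mathsf{mop}_{\Gamma,A}[\gamma]$, $\mathsf{mcoh}_{\Gamma,A}[\gamma]$ for $\Gamma$ a $\mathsf{CaTT}$ ps-context, $A$ a valid operation (resp. coherence) type in $\mathsf{CaTT}$ and $\Delta\vdash\gamma:\mathrm{D}\Gamma$, of type $(\mathrm{D}A)[\gamma]$. $\mathrm{Syn}(T)$ is the syntactic category (contexts and substitutions, up to definitional equality).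 The desuspension $\mathrm{D}$ is defined by $\mathrm{D}\star=\mathbb{1}$, $\mathrm{D}(\mathrm{Hom}_A tu)=\mathrm{Hom}_{\mathrm{D}A}(\mathrm{D}t)(\mathrm{D}u)$, $\mathrm{D}x=x$, $\mathrm{D}(\mathsf{op}_{\Gamma,A}[\gamma])=\mathsf{mop}_{\Gamma,A}[\mathrm{D}\gamma]$, $\mathrm{D}(\mathsf{coh}_{\Gamma,A}[\gamma])=\mathsf{mcoh}_{\Gamma,A}[\mathrm{D}\gamma]$, componentwise on contexts and substitutions. The reduced suspension $\Sigma_r$ is defined on derivable $\mathsf{MCaTT}$ expressions in normal form using a fresh variable $\bullet$: $\Sigma_r\emptyset=(\bullet:\star)$, $\Sigma_r(\Gamma,x:\mathbb{1})=\Sigma_r\Gamma$, $\Sigma_r(\Gamma,x:A)=(\Sigma_r\Gamma,x:\Sigma_rA)$ for $A\neq\mathbb{1}$; $\Sigma_r\mathbb{1}=\star$, $\Sigma_r\star=\mathrm{Hom}_\star\bullet\bullet$, $\Sigma_r(\mathrm{Hom}_Atu)=\mathrm{Hom}_{\Sigma_rA}(\Sigma_rt)(\Sigma_ru)$; $\Sigma_r()=\bullet$, $\Sigma_rx=x$ for variables of type $\neq\mathbb{1}$, $\Sigma_r(\mathsf{mop}_{\Theta,A}[\gamma])=\mathsf{op}_{\Theta,A}[\bullet_\Theta\circ\Sigma_r\gamma]$ (similarly $\mathsf{mcoh}\mapsto\mathsf{coh}$); $\Sigma_r\langle\rangle=\langle\bullet\mapsto\bullet\rangle$, $\Sigma_r\langle\gamma,x\mapsto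 t\rangle=\Sigma_r\gamma$ if $x$ has type $\mathbb{1}$ and $\langle\Sigma_r\gamma,x\mapsto\Sigma_rt\rangle$ otherwise. For a $\mathsf{CaTT}$ context $\Theta$, the substitution $\bullet_\Theta$ is defined by $\bullet_\emptyset=\langle\rangle$ and $\bullet_{(\Theta,x:A)}=\langle\bullet_\Theta, x\mapsto\Sigma_r(\mathrm{D}x)\rangle$; it is a substitution $\Sigma_r(\mathrm{D}\Theta)\vdash\bullet_\Theta:\Theta$. *)

(* Defs.v *)
From Stdlib Require Import List Arith Lia.
From Stdlib Require Import FunctionalExtensionality PropExtensionality ProofIrrelevance.
Import ListNotations.

Record category := {
  ob :> Type;
  hom : ob -> ob -> Type;
  idm : forall X, hom X X;
  compose : forall X Y Z, hom Y Z -> hom X Y -> hom X Z;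
  compose_id_l : forall X Y (f : hom X Y), compose _ _ _ (idm Y) f = f;
  compose_id_r : forall X Y (f : hom X Y), compose _ _ _ f (idm X) = f;
  compose_assoc : forall X Y Z W (h : hom Z W) (g : hom Y Z) (f : hom X Y),
    compose _ _ _ h (compose _ _ _ g f) = compose _ _ _ (compose _ _ _ h g) f }.

Arguments hom {c} _ _.
Arguments idm {c} _.
Arguments compose {c X Y Z} _ _.

Record functor (C D : category) := {
  fob :> C -> D;
  fmap : forall X Y : C, hom X Y -> hom (fob X) (fob Y);
  fmap_id : forall X : C, fmap _ _ (idm X) = idm (fob X);
  fmap_compose : forall (X Y Z : C) (g : hom Y Z) (f : hom X Y),
    fmap _ _ (compose g f) = compose (fmap _ _ g) (fmap _ _ f) }.

Arguments fob {C D} _ _.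
Arguments fmap {C D} _ {X Y} _.

(** [adjunction L R]: [L] is left adjoint to [R]. *)
Record adjunction {C D : category} (L : functor C D) (R : functor D C) := {
  adj_unit : forall X : C, hom X (R (L X));
  adj_counit : forall Y : D, hom (L (R Y)) Y;
  unit_natural : forall (X X' : C) (f : hom X X'),
    compose (adj_unit X') f = compose (fmap R (fmap L f)) (adj_unit X);
  counit_natural : forall (Y Y' : D) (g : hom Y Y'),
    compose (adj_counit Y') (fmap L (fmap R g)) = compose g (adj_counit Y);
  triangle_left : forall X : C,
    compose (adj_counit (L X)) (fmap L (adj_unit X)) = idm (L X);
  triangle_right : forall Y : D,
    compose (fmap R (adj_counit Y)) (adj_unit (R Y)) = idm (R Y) }.

Arguments adj_unit {C D L R} _ _.
Arguments adj_counit {C D L R} _ _.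

Definition is_iso {C : category} {X Y : C} (f : hom X Y) : Prop :=
  exists g : hom Y X, compose g f = idm X /\ compose f g = idm Y.

Definition fully_faithful {C D : category} (F : functor C D) : Prop :=
  forall (X Y : C) (g : hom (F X) (F Y)),
    exists f : hom X Y, fmap F f = g /\ forall f' : hom X Y, fmap F f' = g -> f' = f.

(** The left adjoint embeds [C] as a coreflective subcategory of [D]. *)
Definition coreflective {C D : category} {L : functor C D} {R : functor D C}
    (_ : adjunction L R) : Prop :=
  fully_faithful L.

(** Variables are names (natural numbers): a context declares names with
    types, and a substitution maps the names of its target context to terms.
    The indices [G, A] of [Op G A g] and [Coh G A g] are closed: substitution
    only acts on [g]. *)
Inductive ty : Type :=
| Star : ty
| Hom : ty -> tm -> tm -> ty
with tm : Type :=
| Var : nat -> tm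
| Op : ctx -> ty -> sub -> tm
| Coh : ctx -> ty -> sub -> tm
with ctx : Type :=
| cnil : ctx
| csnoc : ctx -> nat -> ty -> ctx
with sub : Type :=
| snil : sub
| ssnoc : sub -> nat -> tm -> sub.

Fixpoint cnames (G : ctx) : list nat :=
  match G with
  | cnil => []
  | csnoc G x _ => x :: cnames G
  end.

Fixpoint declares (G : ctx) (x : nat) (A : ty) : Prop :=
  match G with
  | cnil => False
  | csnoc G y B => (x = y /\ A = B) \/ declares G x A
  end.

Fixpoint vars_tm (t : tm) : list nat :=
  match t with
  | Var x => [x]
  | Op _ _ g | Coh _ _ g => vars_sub g
  end
with vars_sub (g : sub) : list nat :=
  match g with
  | snil => []
  | ssnoc g _ t => vars_sub g ++ vars_tm t
  end.

Fixpoint vars_ty (A : ty) : list nat :=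
  match A with
  | Star => []
  | Hom A t u => vars_ty A ++ vars_tm t ++ vars_tm u
  end.

Definition same_names (l l' : list nat) : Prop := forall x, In x l <-> In x l'.

Fixpoint lookup (g : sub) (x : nat) : tm :=
  match g with
  | snil => Var x
  | ssnoc g y t => if Nat.eqb x y then t else lookup g x
  end.

(** [subst_ty A g] is A[g], and [subst_sub th g] is the composite of [th]
    and [g], mapping x to th(x)[g]. *)
Fixpoint subst_tm (t : tm) (g : sub) : tm :=
  match t with
  | Var x => lookup g x
  | Op G A th => Op G A (subst_sub th g)
  | Coh G A th => Coh G A (subst_sub th g)
  end
with subst_sub (th g : sub) : sub :=
  match th with
  | snil => snil
  | ssnoc th x t => ssnoc (subst_sub th g) x (subst_tm t g)
  end.

Fixpoint subst_ty (A : ty) (g : sub) : ty :=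
  match A with
  | Star => Star
  | Hom A t u => Hom (subst_ty A g) (subst_tm t g) (subst_tm u g)
  end.

Fixpoint id_sub (G : ctx) : sub :=
  match G with
  | cnil => snil
  | csnoc G x _ => ssnoc (id_sub G) x (Var x)
  end.

(** A variable of type [A] has dimension [dim_ty A]; objects have dimension 0. *)
Fixpoint dim_ty (A : ty) : nat :=
  match A with
  | Star => 0
  | Hom A _ _ => S (dim_ty A)
  end.

Fixpoint dim_ctx (G : ctx) : nat :=
  match G with
  | cnil => 0
  | csnoc G _ A => Nat.max (dim_ctx G) (dim_ty A)
  end.

Fixpoint clength (G : ctx) : nat :=
  match G with
  | cnil => 0
  | csnoc G _ _ => S (clength G)
  end.

(** The names of a ps-context only serve as bound names in
    [Op G A g] and [Coh G A g], so the rules choose the fresh names to be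
    0, 1, 2, ... in order of declaration: each class of ps-contexts up to
    renaming has exactly one representative. *)
Inductive ps : ctx -> nat -> ty -> Prop :=
| ps_start : ps (csnoc cnil 0 Star) 0 Star
| ps_extend : forall G x A,
    ps G x A ->
    let y := clength G in
    let f := S (clength G) in
    let B := Hom A (Var x) (Var y) in
    ps (csnoc (csnoc G y A) f B) f B
| ps_drop : forall G f A x y,
    ps G f (Hom A (Var x) (Var y)) -> ps G y A.

Definition ps_ctx (G : ctx) : Prop := exists x, ps G x Star.

Fixpoint src (i : nat) (G : ctx) : ctx :=
  match G with
  | csnoc (csnoc G' y A) f B =>
      if i <=? dim_ty A then src i G'
      else csnoc (csnoc (src i G') y A) f B
  | _ => G
  end.

Definition drop (G : ctx) : ctx :=
  match G with
  | cnil => cnil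
  | csnoc G _ _ => G
  end.

Fixpoint tgt (i : nat) (G : ctx) : ctx :=
  match G with
  | csnoc (csnoc G' y A) f B =>
      if i <? dim_ty A then tgt i G'
      else if i =? dim_ty A then csnoc (drop (tgt i G')) y A
      else csnoc (csnoc (tgt i G') y A) f B
  | _ => G
  end.

(** [wfctx G], [wfty G A], [wftm G t A] and [wfsub D g G] are the judgements
    G |-, G |- A, G |- t : A and D |- g : G; [op_type G A] and [coh_type G A]
    say that [A] is a valid operation, resp. coherence, type over [G]. *)
Inductive wfctx : ctx -> Prop :=
| wfctx_nil : wfctx cnil
| wfctx_snoc : forall G x A,
    wfctx G -> wfty G A -> ~ In x (cnames G) -> wfctx (csnoc G x A)
with wfty : ctx -> ty -> Prop :=
| wfty_star : forall G, wfctx G -> wfty G Star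
| wfty_hom : forall G A t u,
    wfty G A -> wftm G t A -> wftm G u A -> wfty G (Hom A t u)
with wftm : ctx -> tm -> ty -> Prop :=
| wftm_var : forall G x A, wfctx G -> declares G x A -> wftm G (Var x) A
| wftm_op : forall D G A g,
    op_type G A -> wfsub D g G -> wftm D (Op G A g) (subst_ty A g)
| wftm_coh : forall D G A g,
    coh_type G A -> wfsub D g G -> wftm D (Coh G A g) (subst_ty A g)
with wfsub : ctx -> sub -> ctx -> Prop :=
| wfsub_nil : forall D, wfctx D -> wfsub D snil cnil
| wfsub_snoc : forall D g G x A t,
    wfsub D g G -> wfctx (csnoc G x A) -> wftm D t (subst_ty A g) ->
    wfsub D (ssnoc g x t) (csnoc G x A)
with op_type : ctx -> ty -> Prop :=
| op_type_intro : forall G n A t u,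
    ps_ctx G -> dim_ctx G = S n ->
    wftm (src n G) t A -> wftm (tgt n G) u A ->
    same_names (vars_tm t ++ vars_ty A) (cnames (src n G)) ->
    same_names (vars_tm u ++ vars_ty A) (cnames (tgt n G)) ->
    op_type G (Hom A t u)
with coh_type : ctx -> ty -> Prop :=
| coh_type_intro : forall G A,
    ps_ctx G -> wfty G A -> same_names (vars_ty A) (cnames G) ->
    coh_type G A.

Inductive mty : Type :=
| MUnit : mty
| MHom : mty -> mtm -> mtm -> mty
with mtm : Type :=
| MVar : nat -> mtm
| Mtt : mtm
| Mop : ctx -> ty -> msub -> mtm
| Mcoh : ctx -> ty -> msub -> mtm
with msub : Type :=
| msnil : msub
| mssnoc : msub -> nat -> mtm -> msub.

Inductive mctx : Type :=
| mcnil : mctx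
| mcsnoc : mctx -> nat -> mty -> mctx.

Fixpoint mcnames (G : mctx) : list nat :=
  match G with
  | mcnil => []
  | mcsnoc G x _ => x :: mcnames G
  end.

Fixpoint mdeclares (G : mctx) (x : nat) (A : mty) : Prop :=
  match G with
  | mcnil => False
  | mcsnoc G y B => (x = y /\ A = B) \/ mdeclares G x A
  end.

Fixpoint mlookup (g : msub) (x : nat) : mtm :=
  match g with
  | msnil => MVar x
  | mssnoc g y t => if Nat.eqb x y then t else mlookup g x
  end.

Fixpoint msubst_tm (t : mtm) (g : msub) : mtm :=
  match t with
  | MVar x => mlookup g x
  | Mtt => Mtt
  | Mop G A th => Mop G A (msubst_sub th g)
  | Mcoh G A th => Mcoh G A (msubst_sub th g)
  end
with msubst_sub (th g : msub) : msub :=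
  match th with
  | msnil => msnil
  | mssnoc th x t => mssnoc (msubst_sub th g) x (msubst_tm t g)
  end.

Fixpoint msubst_ty (A : mty) (g : msub) : mty :=
  match A with
  | MUnit => MUnit
  | MHom A t u => MHom (msubst_ty A g) (msubst_tm t g) (msubst_tm u g)
  end.

Fixpoint mid_sub (G : mctx) : msub :=
  match G with
  | mcnil => msnil
  | mcsnoc G x _ => mssnoc (mid_sub G) x (MVar x)
  end.

Fixpoint desusp_tm (t : tm) : mtm :=
  match t with
  | Var x => MVar x
  | Op G A g => Mop G A (desusp_sub g)
  | Coh G A g => Mcoh G A (desusp_sub g)
  end
with desusp_sub (g : sub) : msub :=
  match g with
  | snil => msnil
  | ssnoc g x t => mssnoc (desusp_sub g) x (desusp_tm t)
  end.

Fixpoint desusp_ty (A : ty) : mty :=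
  match A with
  | Star => MUnit
  | Hom A t u => MHom (desusp_ty A) (desusp_tm t) (desusp_tm u)
  end.

Fixpoint desusp_ctx (G : ctx) : mctx :=
  match G with
  | cnil => mcnil
  | csnoc G x A => mcsnoc (desusp_ctx G) x (desusp_ty A)
  end.

(** The judgements of MCaTT, and the judgemental equalities
    G |- A = B, G |- t = u : A and D |- g = h : G. *)
Inductive wfmctx : mctx -> Prop :=
| wfmctx_nil : wfmctx mcnil
| wfmctx_snoc : forall G x A,
    wfmctx G -> wfmty G A -> ~ In x (mcnames G) -> wfmctx (mcsnoc G x A)
with wfmty : mctx -> mty -> Prop :=
| wfmty_unit : forall G, wfmctx G -> wfmty G MUnit
| wfmty_hom : forall G A t u,
    wfmty G A -> wfmtm G t A -> wfmtm G u A -> wfmty G (MHom A t u)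
with wfmtm : mctx -> mtm -> mty -> Prop :=
| wfmtm_var : forall G x A, wfmctx G -> mdeclares G x A -> wfmtm G (MVar x) A
| wfmtm_tt : forall G, wfmctx G -> wfmtm G Mtt MUnit
| wfmtm_mop : forall D G A g,
    op_type G A -> wfmsub D g (desusp_ctx G) ->
    wfmtm D (Mop G A g) (msubst_ty (desusp_ty A) g)
| wfmtm_mcoh : forall D G A g,
    coh_type G A -> wfmsub D g (desusp_ctx G) ->
    wfmtm D (Mcoh G A g) (msubst_ty (desusp_ty A) g)
| wfmtm_conv : forall G t A B, wfmtm G t A -> eqmty G A B -> wfmtm G t B
with wfmsub : mctx -> msub -> mctx -> Prop :=
| wfmsub_nil : forall D, wfmctx D -> wfmsub D msnil mcnil
| wfmsub_snoc : forall D g G x A t,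
    wfmsub D g G -> wfmctx (mcsnoc G x A) -> wfmtm D t (msubst_ty A g) ->
    wfmsub D (mssnoc g x t) (mcsnoc G x A)
with eqmty : mctx -> mty -> mty -> Prop :=
| eqmty_refl : forall G A, wfmty G A -> eqmty G A A
| eqmty_sym : forall G A B, eqmty G A B -> eqmty G B A
| eqmty_trans : forall G A B C, eqmty G A B -> eqmty G B C -> eqmty G A C
| eqmty_hom : forall G A A' t t' u u',
    eqmty G A A' -> eqmtm G t t' A -> eqmtm G u u' A ->
    eqmty G (MHom A t u) (MHom A' t' u')
with eqmtm : mctx -> mtm -> mtm -> mty -> Prop :=
| eqmtm_refl : forall G t A, wfmtm G t A -> eqmtm G t t A
| eqmtm_sym : forall G t u A, eqmtm G t u A -> eqmtm G u t A
| eqmtm_trans : forall G t u v A, eqmtm G t u A -> eqmtm G u v A -> eqmtm G t v A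
| eqmtm_conv : forall G t u A B, eqmtm G t u A -> eqmty G A B -> eqmtm G t u B
| eqmtm_eta : forall G t, wfmtm G t MUnit -> eqmtm G t Mtt MUnit
| eqmtm_mop : forall D G A g h,
    op_type G A -> eqmsub D g h (desusp_ctx G) ->
    eqmtm D (Mop G A g) (Mop G A h) (msubst_ty (desusp_ty A) g)
| eqmtm_mcoh : forall D G A g h,
    coh_type G A -> eqmsub D g h (desusp_ctx G) ->
    eqmtm D (Mcoh G A g) (Mcoh G A h) (msubst_ty (desusp_ty A) g)
with eqmsub : mctx -> msub -> msub -> mctx -> Prop :=
| eqmsub_nil : forall D, wfmctx D -> eqmsub D msnil msnil mcnil
| eqmsub_snoc : forall D g h G x A t u,
    eqmsub D g h G -> wfmctx (mcsnoc G x A) -> eqmtm D t u (msubst_ty A g) ->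
    eqmsub D (mssnoc g x t) (mssnoc h x u) (mcsnoc G x A).

Inductive eqmctx : mctx -> mctx -> Prop :=
| eqmctx_nil : eqmctx mcnil mcnil
| eqmctx_snoc : forall G G' x A A',
    eqmctx G G' -> eqmty G A A' -> ~ In x (mcnames G) -> ~ In x (mcnames G') ->
    eqmctx (mcsnoc G x A) (mcsnoc G' x A').

(** Normal forms for the eta-rule: no subterm of type [MUnit] other than [Mtt]. *)
Fixpoint normal_tm (G : mctx) (t : mtm) : Prop :=
  (wfmtm G t MUnit -> t = Mtt) /\
  match t with
  | MVar _ | Mtt => True
  | Mop _ _ g | Mcoh _ _ g => normal_sub G g
  end
with normal_sub (G : mctx) (g : msub) : Prop :=
  match g with
  | msnil => True
  | mssnoc g _ t => normal_sub G g /\ normal_tm G t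
  end.

Fixpoint normal_ty (G : mctx) (A : mty) : Prop :=
  match A with
  | MUnit => True
  | MHom A t u => normal_ty G A /\ normal_tm G t /\ normal_tm G u
  end.

Fixpoint normal_ctx (G : mctx) : Prop :=
  match G with
  | mcnil => True
  | mcsnoc G _ A => normal_ctx G /\ normal_ty G A
  end.

(** The fresh variable is the name 0, and the name [x] of MCaTT becomes [S x]:
    this renaming is what makes 0 fresh. *)
Definition bullet : nat := 0.

(** The component of [bullet_sub] at a variable declared with type [Star]
    (resp. another type) is the reduced suspension of the normal form
    [Mtt] (resp. [MVar x]) of its desuspension. *)
Fixpoint bullet_sub (G : ctx) : sub :=
  match G with
  | cnil => snil
  | csnoc G x Star => ssnoc (bullet_sub G) x (Var bullet)
  | csnoc G x (Hom _ _ _) => ssnoc (bullet_sub G) x (Var (S x))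
  end.

(** [rsusp_sub g G] takes the target context [G] of [g] as an argument. These
    functions are only meaningful on derivable normal forms; in particular
    variables of type [MUnit] do not occur in normal terms. *)
Fixpoint rsusp_tm (t : mtm) : tm :=
  match t with
  | MVar x => Var (S x)
  | Mtt => Var bullet
  | Mop T A g => Op T A (subst_sub (bullet_sub T) (rsusp_sub g (desusp_ctx T)))
  | Mcoh T A g => Coh T A (subst_sub (bullet_sub T) (rsusp_sub g (desusp_ctx T)))
  end
with rsusp_sub (g : msub) (G : mctx) : sub :=
  match g, G with
  | mssnoc g x t, mcsnoc G _ MUnit => rsusp_sub g G
  | mssnoc g x t, mcsnoc G _ (MHom _ _ _) => ssnoc (rsusp_sub g G) (S x) (rsusp_tm t)
  | _, _ => ssnoc snil bullet (Var bullet)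
  end.

Fixpoint rsusp_ty (A : mty) : ty :=
  match A with
  | MUnit => Star
  | MHom A t u => Hom (rsusp_ty A) (rsusp_tm t) (rsusp_tm u)
  end.

Fixpoint rsusp_ctx (G : mctx) : ctx :=
  match G with
  | mcnil => csnoc cnil bullet Star
  | mcsnoc G _ MUnit => rsusp_ctx G
  | mcsnoc G x A => csnoc (rsusp_ctx G) (S x) (rsusp_ty A)
  end.

Scheme tm_sub_ind := Induction for tm Sort Prop
  with sub_tm_ind := Induction for sub Sort Prop.
Combined Scheme tm_sub_mutind from tm_sub_ind, sub_tm_ind.

Scheme wfctx_mind := Minimality for wfctx Sort Prop
  with wfty_mind := Minimality for wfty Sort Prop
  with wftm_mind := Minimality for wftm Sort Prop
  with wfsub_mind := Minimality for wfsub Sort Prop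
  with op_type_mind := Minimality for op_type Sort Prop
  with coh_type_mind := Minimality for coh_type Sort Prop.
Combined Scheme wf_mutind from wfctx_mind, wfty_mind, wftm_mind, wfsub_mind,
  op_type_mind, coh_type_mind.

Fixpoint snames (g : sub) : list nat :=
  match g with
  | snil => []
  | ssnoc g x _ => x :: snames g
  end.

Lemma subst_agree :
  (forall t g h, (forall x, In x (vars_tm t) -> lookup g x = lookup h x) ->
     subst_tm t g = subst_tm t h) /\
  (forall th g h, (forall x, In x (vars_sub th) -> lookup g x = lookup h x) ->
     subst_sub th g = subst_sub th h).
Proof.
  apply tm_sub_mutind; cbn; intros; auto; f_equal; auto;
    [apply H | apply H0]; intros; apply H1; apply in_or_app; auto.
Qed.

Lemma subst_ty_agree A g h :
  (forall x, In x (vars_ty A) -> lookup g x = lookup h x) ->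
  subst_ty A g = subst_ty A h.
Proof.
  induction A; cbn; intros E; auto.
  f_equal; [apply IHA | apply subst_agree | apply subst_agree];
    intros; apply E; rewrite !in_app_iff; auto.
Qed.

Lemma lookup_subst_sub th g x :
  In x (snames th) -> lookup (subst_sub th g) x = subst_tm (lookup th x) g.
Proof.
  induction th as [|th IH y t]; cbn; [tauto|]. intros H.
  destruct (Nat.eqb_spec x y); auto. apply IH. destruct H; congruence.
Qed.

Lemma subst_comp th g :
  (forall t, incl (vars_tm t) (snames th) ->
     subst_tm (subst_tm t th) g = subst_tm t (subst_sub th g)) /\
  (forall s, incl (vars_sub s) (snames th) ->
     subst_sub (subst_sub s th) g = subst_sub s (subst_sub th g)).
Proof.
  apply tm_sub_mutind; cbn; intros; try (f_equal; auto; fail).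
  - symmetry; apply lookup_subst_sub; auto with datatypes.
  - f_equal; [apply H | apply H0]; intros y Hy; apply H1; auto with datatypes.
Qed.

Lemma subst_ty_comp A th g :
  incl (vars_ty A) (snames th) ->
  subst_ty (subst_ty A th) g = subst_ty A (subst_sub th g).
Proof.
  induction A; cbn; intros H; auto.
  f_equal; [apply IHA | apply subst_comp | apply subst_comp];
    intros y Hy; apply H; rewrite !in_app_iff; auto.
Qed.

Lemma lookup_id G x : lookup (id_sub G) x = Var x.
Proof.
  induction G as [|G IH y A]; cbn; auto.
  destruct (Nat.eqb_spec x y); congruence.
Qed.

Lemma subst_id G :
  (forall t, subst_tm t (id_sub G) = t) /\
  (forall g, subst_sub g (id_sub G) = g).
Proof.
  apply tm_sub_mutind; cbn; intros; auto using lookup_id; f_equal; auto.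
Qed.

Lemma subst_ty_id G A : subst_ty A (id_sub G) = A.
Proof. induction A; cbn; f_equal; auto; apply subst_id. Qed.

Lemma subst_skip g x t :
  (forall u, ~ In x (vars_tm u) -> subst_tm u (ssnoc g x t) = subst_tm u g) /\
  (forall h, ~ In x (vars_sub h) -> subst_sub h (ssnoc g x t) = subst_sub h g).
Proof.
  split; intros; apply subst_agree; intros y Hy; cbn;
    destruct (Nat.eqb_spec y x); congruence.
Qed.

Lemma subst_ty_skip A g x t :
  ~ In x (vars_ty A) -> subst_ty A (ssnoc g x t) = subst_ty A g.
Proof.
  intros H; apply subst_ty_agree; intros y Hy; cbn.
  destruct (Nat.eqb_spec y x); congruence.
Qed.

Lemma declares_name G x A : declares G x A -> In x (cnames G).
Proof. induction G; cbn; [tauto|]. intros [[-> _]|]; auto. Qed.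

Lemma wfsub_names D g G : wfsub D g G -> snames g = cnames G.
Proof. induction 1; cbn; congruence. Qed.

Lemma wf_ctx :
  (forall G, wfctx G -> True) /\
  (forall G A, wfty G A -> wfctx G) /\
  (forall G t A, wftm G t A -> wfctx G) /\
  (forall D g G, wfsub D g G -> wfctx D /\ wfctx G) /\
  (forall G A, op_type G A -> True) /\
  (forall G A, coh_type G A -> True).
Proof. apply wf_mutind; intuition; constructor. Qed.

Lemma name_declared G x : In x (cnames G) -> exists A, declares G x A.
Proof.
  induction G as [|G IH y B]; cbn; [tauto|].
  intros [->|[A H]%IH]; eauto.
Qed.

Lemma src_declares i G x A : declares (src i G) x A -> declares G x A.
Proof.
  enough (E : (declares (src i G) x A -> declares G x A) /\
    forall y B, declares (src i (csnoc G y B)) x A -> declares (csnoc G y B) x A)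
    by apply E.
  induction G as [|G [IH1 IH2] z C].
  - split; auto.
  - split; [apply IH2|]. intros y B. cbn [src].
    destruct (_ <=? _); cbn; tauto.
Qed.

Lemma declares_drop G x A : declares (drop G) x A -> declares G x A.
Proof. destruct G; cbn; auto. Qed.

Lemma tgt_declares i G x A : declares (tgt i G) x A -> declares G x A.
Proof.
  enough (E : (declares (tgt i G) x A -> declares G x A) /\
    forall y B, declares (tgt i (csnoc G y B)) x A -> declares (csnoc G y B) x A)
    by apply E.
  induction G as [|G [IH1 IH2] z C].
  - split; auto.
  - split; [apply IH2|]. intros y B. cbn [tgt].
    destruct (_ <? _); [cbn; tauto|].
    destruct (_ =? _); cbn; [|tauto].
    intros [|H%declares_drop]; tauto.
Qed.

Lemma src_names i G : incl (cnames (src i G)) (cnames G).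
Proof.
  intros x [A H%src_declares]%name_declared; eauto using declares_name.
Qed.

Lemma tgt_names i G : incl (cnames (tgt i G)) (cnames G).
Proof.
  intros x [A H%tgt_declares]%name_declared; eauto using declares_name.
Qed.

Lemma op_type_vars G A : op_type G A -> incl (vars_ty A) (cnames G).
Proof.
  intros [G' n A' t u _ _ _ _ Ht Hu]; cbn.
  intros x; rewrite !in_app_iff. intros [H|[H|H]].
  - apply (src_names n), Ht, in_or_app; auto.
  - apply (src_names n), Ht, in_or_app; auto.
  - apply (tgt_names n), Hu, in_or_app; auto.
Qed.

Lemma coh_type_vars G A : coh_type G A -> incl (vars_ty A) (cnames G).
Proof. intros [G' A' _ _ H] x Hx; apply H, Hx. Qed.

Lemma wf_vars :
  (forall G, wfctx G -> forall x A, declares G x A -> incl (vars_ty A) (cnames G)) /\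
  (forall G A, wfty G A -> incl (vars_ty A) (cnames G)) /\
  (forall G t A, wftm G t A -> incl (vars_tm t) (cnames G)) /\
  (forall D g G, wfsub D g G -> incl (vars_sub g) (cnames D)) /\
  (forall G A, op_type G A -> True) /\
  (forall G A, coh_type G A -> True).
Proof.
  apply wf_mutind; cbn; intros; auto using incl_app, incl_nil_l.
  - tauto.
  - destruct H4 as [[-> ->]|H4]; auto with datatypes.
    apply incl_tl. eauto.
  - intros y [<-|[]]. eapply declares_name; eauto.
Qed.

Lemma lookup_wf D g G : wfsub D g G ->
  forall x A, declares G x A -> wftm D (lookup g x) (subst_ty A g).
Proof.
  induction 1 as [|D g G x A t Hg IH HG Ht]; cbn; [tauto|]. intros y B Hy.
  inversion HG as [|? ? ? HG' HA Hx]; subst.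
  assert (incl (vars_ty B) (cnames G)) as HB.
  { destruct Hy as [[-> ->]|Hy]; [apply wf_vars in HA; auto|].
    exact (proj1 wf_vars _ HG' _ _ Hy). }
  rewrite subst_ty_skip by (intros E; apply Hx, HB, E).
  destruct (Nat.eqb_spec y x) as [->|N].
  - destruct Hy as [[_ ->]|Hy]; auto. apply declares_name in Hy; tauto.
  - destruct Hy as [[-> _]|Hy]; [congruence|auto].
Qed.

Lemma wf_subst :
  (forall G, wfctx G -> True) /\
  (forall G A, wfty G A -> forall D g, wfsub D g G -> wfty D (subst_ty A g)) /\
  (forall G t A, wftm G t A -> forall D g, wfsub D g G ->
     wftm D (subst_tm t g) (subst_ty A g)) /\
  (forall G th T, wfsub G th T -> forall D g, wfsub D g G ->
     wfsub D (subst_sub th g) T) /\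
  (forall G A, op_type G A -> True) /\
  (forall G A, coh_type G A -> True).
Proof.
  apply wf_mutind; cbn; intros; auto.
  - constructor. apply wf_ctx in H1; tauto.
  - constructor; auto.
  - eapply lookup_wf; eauto.
  - rewrite subst_ty_comp; [constructor; auto|].
    erewrite wfsub_names by eauto. apply op_type_vars; auto.
  - rewrite subst_ty_comp; [constructor; auto|].
    erewrite wfsub_names by eauto. apply coh_type_vars; auto.
  - constructor. apply wf_ctx in H1; tauto.
  - constructor; auto. rewrite <- subst_ty_comp; auto.
    erewrite wfsub_names by eauto.
    inversion H1 as [|? ? ? _ HA _]; subst. apply wf_vars in HA; auto.
Qed.

Lemma id_sub_wf D G : wfctx D -> wfctx G ->
  (forall x A, declares G x A -> declares D x A) -> wfsub D (id_sub G) G.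
Proof.
  intros HD HG; induction G as [|G IH x A]; cbn; intros Hi; [constructor; auto|].
  inversion HG; subst. constructor; auto.
  constructor; auto. apply Hi. rewrite subst_ty_id; auto.
Qed.

Lemma subst_id_sub G g : NoDup (cnames G) -> snames g = cnames G ->
  subst_sub (id_sub G) g = g.
Proof.
  revert g; induction G as [|G IH x A]; intros [|g y t] N E; cbn in *;
    try congruence.
  inversion N; subst. injection E as -> E. rewrite Nat.eqb_refl.
  f_equal. rewrite <- (IH g) at 2 by auto.
  apply subst_skip. clear - H1.
  assert (vars_sub (id_sub G) = rev (cnames G)) as ->.
  { clear; induction G; cbn; congruence. }
  rewrite <- in_rev; auto.
Qed.

Lemma wfctx_nodup G : wfctx G -> NoDup (cnames G).
Proof. induction G; cbn; intros H; inversion H; subst; constructor; auto. Qed.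

Definition wf_context : Type := {G : ctx | wfctx G}.
Definition wf_sub (D G : wf_context) : Type :=
  {g : sub | wfsub (proj1_sig D) g (proj1_sig G)}.

Lemma wf_sub_eq (D G : wf_context) (g h : wf_sub D G) :
  proj1_sig g = proj1_sig h -> g = h.
Proof.
  destruct g, h; cbn; intros; subst; f_equal; apply proof_irrelevance.
Qed.

Program Definition SynCaTT : category := {|
  ob := wf_context;
  hom := wf_sub;
  idm := fun G => id_sub (proj1_sig G);
  compose := fun X Y Z g f => subst_sub (proj1_sig g) (proj1_sig f) |}.
Next Obligation. destruct G as [G HG]; cbn. apply id_sub_wf; auto. Qed.
Next Obligation. destruct g, f; cbn in *. eapply wf_subst; eauto. Qed.
Next Obligation.
  apply wf_sub_eq; destruct Y as [Y HY], f as [f Hf]; cbn in *.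
  apply subst_id_sub; eauto using wfctx_nodup, wfsub_names.
Qed.
Next Obligation. apply wf_sub_eq; cbn; apply subst_id. Qed.
Next Obligation.
  apply wf_sub_eq; destruct f as [f Hf], g as [g Hg], h as [h Hh]; cbn in *.
  symmetry. apply subst_comp. rewrite (wfsub_names _ _ _ Hg).
  apply wf_vars in Hh; auto.
Qed.

Scheme mtm_msub_ind := Induction for mtm Sort Prop
  with msub_mtm_ind := Induction for msub Sort Prop.
Combined Scheme mtm_msub_mutind from mtm_msub_ind, msub_mtm_ind.

Scheme wfmctx_mind := Minimality for wfmctx Sort Prop
  with wfmty_mind := Minimality for wfmty Sort Prop
  with wfmtm_mind := Minimality for wfmtm Sort Prop
  with wfmsub_mind := Minimality for wfmsub Sort Prop
  with eqmty_mind := Minimality for eqmty Sort Prop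
  with eqmtm_mind := Minimality for eqmtm Sort Prop
  with eqmsub_mind := Minimality for eqmsub Sort Prop.
Combined Scheme wfm_mutind from wfmctx_mind, wfmty_mind, wfmtm_mind, wfmsub_mind,
  eqmty_mind, eqmtm_mind, eqmsub_mind.

Fixpoint msnames (g : msub) : list nat :=
  match g with
  | msnil => []
  | mssnoc g x _ => x :: msnames g
  end.

Fixpoint mvars_tm (t : mtm) : list nat :=
  match t with
  | MVar x => [x]
  | Mtt => []
  | Mop _ _ g | Mcoh _ _ g => mvars_sub g
  end
with mvars_sub (g : msub) : list nat :=
  match g with
  | msnil => []
  | mssnoc g _ t => mvars_sub g ++ mvars_tm t
  end.

Fixpoint mvars_ty (A : mty) : list nat :=
  match A with
  | MUnit => []
  | MHom A t u => mvars_ty A ++ mvars_tm t ++ mvars_tm u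
  end.

Lemma msubst_agree :
  (forall t g h, (forall x, In x (mvars_tm t) -> mlookup g x = mlookup h x) ->
     msubst_tm t g = msubst_tm t h) /\
  (forall th g h, (forall x, In x (mvars_sub th) -> mlookup g x = mlookup h x) ->
     msubst_sub th g = msubst_sub th h).
Proof.
  apply mtm_msub_mutind; cbn; intros; auto; f_equal; auto;
    [apply H | apply H0]; intros; apply H1; apply in_or_app; auto.
Qed.

Lemma msubst_ty_agree A g h :
  (forall x, In x (mvars_ty A) -> mlookup g x = mlookup h x) ->
  msubst_ty A g = msubst_ty A h.
Proof.
  induction A; cbn; intros E; auto.
  f_equal; [apply IHA | apply msubst_agree | apply msubst_agree];
    intros; apply E; rewrite !in_app_iff; auto.
Qed.

Lemma mlookup_msubst_sub th g x :
  In x (msnames th) -> mlookup (msubst_sub th g) x = msubst_tm (mlookup th x) g.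
Proof.
  induction th as [|th IH y t]; cbn; [tauto|]. intros H.
  destruct (Nat.eqb_spec x y); auto. apply IH. destruct H; congruence.
Qed.

Lemma msubst_comp th g :
  (forall t, incl (mvars_tm t) (msnames th) ->
     msubst_tm (msubst_tm t th) g = msubst_tm t (msubst_sub th g)) /\
  (forall s, incl (mvars_sub s) (msnames th) ->
     msubst_sub (msubst_sub s th) g = msubst_sub s (msubst_sub th g)).
Proof.
  apply mtm_msub_mutind; cbn; intros; try (f_equal; auto; fail).
  - symmetry; apply mlookup_msubst_sub; auto with datatypes.
  - f_equal; [apply H | apply H0]; intros y Hy; apply H1; auto with datatypes.
Qed.

Lemma msubst_ty_comp A th g :
  incl (mvars_ty A) (msnames th) ->
  msubst_ty (msubst_ty A th) g = msubst_ty A (msubst_sub th g).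
Proof.
  induction A; cbn; intros H; auto.
  f_equal; [apply IHA | apply msubst_comp | apply msubst_comp];
    intros y Hy; apply H; rewrite !in_app_iff; auto.
Qed.

Lemma mlookup_id G x : mlookup (mid_sub G) x = MVar x.
Proof.
  induction G as [|G IH y A]; cbn; auto.
  destruct (Nat.eqb_spec x y); congruence.
Qed.

Lemma msubst_id G :
  (forall t, msubst_tm t (mid_sub G) = t) /\
  (forall g, msubst_sub g (mid_sub G) = g).
Proof.
  apply mtm_msub_mutind; cbn; intros; auto using mlookup_id; f_equal; auto.
Qed.

Lemma msubst_ty_id G A : msubst_ty A (mid_sub G) = A.
Proof. induction A; cbn; f_equal; auto; apply msubst_id. Qed.

Lemma msubst_skip g x t :
  (forall u, ~ In x (mvars_tm u) -> msubst_tm u (mssnoc g x t) = msubst_tm u g) /\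
  (forall h, ~ In x (mvars_sub h) -> msubst_sub h (mssnoc g x t) = msubst_sub h g).
Proof.
  split; intros; apply msubst_agree; intros y Hy; cbn;
    destruct (Nat.eqb_spec y x); congruence.
Qed.

Lemma msubst_ty_skip A g x t :
  ~ In x (mvars_ty A) -> msubst_ty A (mssnoc g x t) = msubst_ty A g.
Proof.
  intros H; apply msubst_ty_agree; intros y Hy; cbn.
  destruct (Nat.eqb_spec y x); congruence.
Qed.

Lemma mdeclares_name G x A : mdeclares G x A -> In x (mcnames G).
Proof. induction G; cbn; [tauto|]. intros [[-> _]|]; auto. Qed.

Lemma wfmsub_names D g G : wfmsub D g G -> msnames g = mcnames G.
Proof. induction 1; cbn; congruence. Qed.

Lemma mid_names G : msnames (mid_sub G) = mcnames G.
Proof. induction G; cbn; congruence. Qed.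

Lemma msubst_id_sub G g : NoDup (mcnames G) -> msnames g = mcnames G ->
  msubst_sub (mid_sub G) g = g.
Proof.
  revert g; induction G as [|G IH x A]; intros [|g y t] N E; cbn in *;
    try congruence.
  inversion N; subst. injection E as -> E. rewrite Nat.eqb_refl.
  f_equal. rewrite <- (IH g) at 2 by auto.
  apply msubst_skip. clear - H1.
  assert (mvars_sub (mid_sub G) = rev (mcnames G)) as ->.
  { clear; induction G; cbn; congruence. }
  rewrite <- in_rev; auto.
Qed.

Lemma wfmctx_nodup G : wfmctx G -> NoDup (mcnames G).
Proof. induction G; cbn; intros H; inversion H; subst; constructor; auto. Qed.

Lemma desusp_names G : mcnames (desusp_ctx G) = cnames G.
Proof. induction G; cbn; congruence. Qed.

Lemma desusp_vars :
  (forall t, mvars_tm (desusp_tm t) = vars_tm t) /\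
  (forall g, mvars_sub (desusp_sub g) = vars_sub g).
Proof. apply tm_sub_mutind; cbn; intros; congruence. Qed.

Lemma desusp_vars_ty A : mvars_ty (desusp_ty A) = vars_ty A.
Proof.
  induction A; cbn; auto.
  rewrite IHA, !(proj1 desusp_vars); auto.
Qed.

Lemma desusp_lookup g x : mlookup (desusp_sub g) x = desusp_tm (lookup g x).
Proof. induction g as [|g IH y t]; cbn; auto. destruct (_ =? _); auto. Qed.

Lemma desusp_subst g :
  (forall t, desusp_tm (subst_tm t g) = msubst_tm (desusp_tm t) (desusp_sub g)) /\
  (forall h, desusp_sub (subst_sub h g) = msubst_sub (desusp_sub h) (desusp_sub g)).
Proof.
  apply tm_sub_mutind; cbn; intros; auto using desusp_lookup; f_equal; auto.
Qed.

Lemma desusp_subst_ty g A :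
  desusp_ty (subst_ty A g) = msubst_ty (desusp_ty A) (desusp_sub g).
Proof. induction A; cbn; f_equal; auto; apply desusp_subst. Qed.

Lemma desusp_declares G x A :
  declares G x A -> mdeclares (desusp_ctx G) x (desusp_ty A).
Proof. induction G; cbn; intuition congruence. Qed.

Lemma wf_desusp :
  (forall G, wfctx G -> wfmctx (desusp_ctx G)) /\
  (forall G A, wfty G A -> wfmty (desusp_ctx G) (desusp_ty A)) /\
  (forall G t A, wftm G t A -> wfmtm (desusp_ctx G) (desusp_tm t) (desusp_ty A)) /\
  (forall D g G, wfsub D g G ->
     wfmsub (desusp_ctx D) (desusp_sub g) (desusp_ctx G)) /\
  (forall G A, op_type G A -> True) /\
  (forall G A, coh_type G A -> True).
Proof.
  apply wf_mutind; cbn; intros; auto; rewrite ?desusp_subst_ty.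
  - constructor.
  - constructor; auto. rewrite desusp_names; auto.
  - constructor; auto.
  - constructor; auto.
  - constructor; auto. apply desusp_declares; auto.
  - constructor; auto.
  - constructor; auto.
  - constructor; auto.
  - constructor; auto. rewrite <- desusp_subst_ty; auto.
Qed.

Lemma wf_declares G x A : wfctx G -> declares G x A -> wfty G A.
Proof.
  intros HG; induction G as [|G IH y B]; cbn; [tauto|]. intros H.
  inversion HG; subst.
  assert (wfsub (csnoc G y B) (id_sub G) G) by (apply id_sub_wf; cbn; auto).
  assert (wfty G A) by (destruct H as [[-> ->]|H]; auto).
  rewrite <- (subst_ty_id G). eapply wf_subst; eauto.
Qed.

Lemma ps_wf G x A : ps G x A ->
  wfctx G /\ declares G x A /\ forall y, In y (cnames G) -> y < clength G.
Proof.
  induction 1 as [|G x A _ (HG & HD & HN) y f B|G f A x y _ (HG & HD & HN)].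
  - repeat split; cbn; auto; [|intros y [<-|[]]; auto].
    constructor; cbn; auto; constructor; constructor.
  - assert (HA : wfty G A) by (eapply wf_declares; eauto).
    assert (HGy : wfctx (csnoc G y A)).
    { constructor; auto. intros E%HN. unfold y in E; lia. }
    assert (wfty (csnoc G y A) A).
    { apply (wf_declares _ y); cbn; auto. }
    repeat split; cbn; auto.
    + constructor; auto.
      * constructor; auto; constructor; cbn; auto.
      * cbn. intros [E|E%HN]; unfold f, y in E; lia.
    + intros z [<-|[<-|E%HN]]; unfold f, y; lia.
  - repeat split; auto.
    apply wf_declares in HD; auto. inversion HD as [|? ? ? ? _ _ Hy]; subst.
    inversion Hy; auto.
Qed.

Lemma wf_type :
  (forall G, wfctx G -> True) /\
  (forall G A, wfty G A -> True) /\
  (forall G t A, wftm G t A -> wfty G A) /\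
  (forall D g G, wfsub D g G -> True) /\
  (forall G A, op_type G A -> wfty G A) /\
  (forall G A, coh_type G A -> wfty G A).
Proof.
  apply wf_mutind; intros; auto.
  - eapply wf_declares; eauto.
  - eapply wf_subst; eauto.
  - eapply wf_subst; eauto.
  - destruct H as [x [HG _]%ps_wf].
    assert (Hs : wfsub G (id_sub (src n G)) (src n G)).
    { apply id_sub_wf; eauto using src_declares. exact (proj1 (proj2 (proj2 wf_ctx)) _ _ _ H1). }
    assert (Hr : wfsub G (id_sub (tgt n G)) (tgt n G)).
    { apply id_sub_wf; eauto using tgt_declares. exact (proj1 (proj2 (proj2 wf_ctx)) _ _ _ H3). }
    apply (proj1 (proj2 (proj2 wf_subst)) _ _ _ H1) in Hs as Ht.
    apply (proj1 (proj2 (proj2 wf_subst)) _ _ _ H3) in Hr as Hu.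
    apply (proj1 (proj2 wf_subst) _ _ H2) in Hs as HA.
    rewrite subst_ty_id in Ht, Hu, HA.
    rewrite (proj1 (subst_id _)) in Ht.
    rewrite (proj1 (subst_id _)) in Hu.
    constructor; auto.
Qed.

Lemma op_type_wf G A : op_type G A -> wfty G A.
Proof. apply wf_type. Qed.

Lemma coh_type_wf G A : coh_type G A -> wfty G A.
Proof. apply wf_type. Qed.

Lemma wfm_ctx :
  (forall G, wfmctx G -> True) /\
  (forall G A, wfmty G A -> wfmctx G) /\
  (forall G t A, wfmtm G t A -> wfmctx G) /\
  (forall D g G, wfmsub D g G -> wfmctx D /\ wfmctx G) /\
  (forall G A B, eqmty G A B -> wfmctx G) /\
  (forall G t u A, eqmtm G t u A -> wfmctx G) /\
  (forall D g h G, eqmsub D g h G -> wfmctx D /\ wfmctx G).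
Proof. apply wfm_mutind; intuition; constructor. Qed.

Lemma op_type_mvars G A : op_type G A -> incl (mvars_ty (desusp_ty A)) (mcnames (desusp_ctx G)).
Proof. rewrite desusp_vars_ty, desusp_names. apply op_type_vars. Qed.

Lemma coh_type_mvars G A : coh_type G A -> incl (mvars_ty (desusp_ty A)) (mcnames (desusp_ctx G)).
Proof. rewrite desusp_vars_ty, desusp_names. apply coh_type_vars. Qed.

Lemma wfm_vars :
  (forall G, wfmctx G ->
     forall x A, mdeclares G x A -> incl (mvars_ty A) (mcnames G)) /\
  (forall G A, wfmty G A -> incl (mvars_ty A) (mcnames G)) /\
  (forall G t A, wfmtm G t A -> incl (mvars_tm t) (mcnames G)) /\
  (forall D g G, wfmsub D g G -> incl (mvars_sub g) (mcnames D)) /\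
  (forall G A B, eqmty G A B -> True) /\
  (forall G t u A, eqmtm G t u A -> True) /\
  (forall D g h G, eqmsub D g h G -> True).
Proof.
  apply wfm_mutind; cbn; intros; auto using incl_app, incl_nil_l.
  - tauto.
  - destruct H4 as [[-> ->]|H4]; auto with datatypes.
    apply incl_tl. eauto.
  - intros y [<-|[]]. eapply mdeclares_name; eauto.
Qed.

Lemma mlookup_wf D g G : wfmsub D g G ->
  forall x A, mdeclares G x A -> wfmtm D (mlookup g x) (msubst_ty A g).
Proof.
  induction 1 as [|D g G x A t Hg IH HG Ht]; cbn; [tauto|]. intros y B Hy.
  inversion HG as [|? ? ? HG' HA Hx]; subst.
  assert (incl (mvars_ty B) (mcnames G)) as HB.
  { destruct Hy as [[-> ->]|Hy]; [apply wfm_vars in HA; auto|].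
    exact (proj1 wfm_vars _ HG' _ _ Hy). }
  rewrite msubst_ty_skip by (intros E; apply Hx, HB, E).
  destruct (Nat.eqb_spec y x) as [->|N].
  - destruct Hy as [[_ ->]|Hy]; auto. apply mdeclares_name in Hy; tauto.
  - destruct Hy as [[-> _]|Hy]; [congruence|auto].
Qed.

Lemma mlookup_eq D g h G : eqmsub D g h G ->
  forall x A, mdeclares G x A ->
  eqmtm D (mlookup g x) (mlookup h x) (msubst_ty A g).
Proof.
  induction 1 as [|D g h G x A t u Hg IH HG Ht]; cbn; [tauto|]. intros y B Hy.
  inversion HG as [|? ? ? HG' HA Hx]; subst.
  assert (incl (mvars_ty B) (mcnames G)) as HB.
  { destruct Hy as [[-> ->]|Hy]; [apply wfm_vars in HA; auto|].
    exact (proj1 wfm_vars _ HG' _ _ Hy). }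
  rewrite msubst_ty_skip by (intros E; apply Hx, HB, E).
  destruct (Nat.eqb_spec y x) as [->|N].
  - destruct Hy as [[_ ->]|Hy]; auto. apply mdeclares_name in Hy; tauto.
  - destruct Hy as [[-> _]|Hy]; [congruence|auto].
Qed.

Lemma eqmsub_names D g h G : eqmsub D g h G ->
  msnames g = mcnames G /\ msnames h = mcnames G.
Proof. induction 1; cbn; intuition congruence. Qed.

Lemma wfm_subst :
  (forall G, wfmctx G -> True) /\
  (forall G A, wfmty G A -> forall D g, wfmsub D g G -> wfmty D (msubst_ty A g)) /\
  (forall G t A, wfmtm G t A -> forall D g, wfmsub D g G ->
     wfmtm D (msubst_tm t g) (msubst_ty A g)) /\
  (forall G th T, wfmsub G th T -> forall D g, wfmsub D g G ->
     wfmsub D (msubst_sub th g) T) /\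
  (forall G A B, eqmty G A B -> forall D g, wfmsub D g G ->
     eqmty D (msubst_ty A g) (msubst_ty B g)) /\
  (forall G t u A, eqmtm G t u A -> forall D g, wfmsub D g G ->
     eqmtm D (msubst_tm t g) (msubst_tm u g) (msubst_ty A g)) /\
  (forall G th th' T, eqmsub G th th' T -> forall D g, wfmsub D g G ->
     eqmsub D (msubst_sub th g) (msubst_sub th' g) T).
Proof.
  apply wfm_mutind; cbn; intros; auto.
  - constructor. apply wfm_ctx in H1; tauto.
  - constructor; auto.
  - eapply mlookup_wf; eauto.
  - constructor. apply wfm_ctx in H1; tauto.
  - rewrite msubst_ty_comp; [constructor; auto|].
    erewrite wfmsub_names by eauto. apply op_type_mvars; auto.
  - rewrite msubst_ty_comp; [constructor; auto|].
    erewrite wfmsub_names by eauto. apply coh_type_mvars; auto.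
  - eapply wfmtm_conv; eauto.
  - constructor. apply wfm_ctx in H1; tauto.
  - constructor; auto. rewrite <- msubst_ty_comp; auto.
    erewrite wfmsub_names by eauto.
    inversion H1 as [|? ? ? _ HA _]; subst. apply wfm_vars in HA; auto.
  - apply eqmty_refl; auto.
  - apply eqmty_sym; auto.
  - eapply eqmty_trans; eauto.
  - apply eqmty_hom; auto.
  - apply eqmtm_refl; auto.
  - apply eqmtm_sym; auto.
  - eapply eqmtm_trans; eauto.
  - eapply eqmtm_conv; eauto.
  - apply eqmtm_eta; eauto.
  - rewrite msubst_ty_comp; [apply eqmtm_mop; auto|].
    rewrite (proj1 (eqmsub_names _ _ _ _ H0)). apply op_type_mvars; auto.
  - rewrite msubst_ty_comp; [apply eqmtm_mcoh; auto|].
    rewrite (proj1 (eqmsub_names _ _ _ _ H0)). apply coh_type_mvars; auto.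
  - constructor. apply wfm_ctx in H1; tauto.
  - constructor; auto. rewrite <- msubst_ty_comp; auto.
    rewrite (proj1 (eqmsub_names _ _ _ _ H)).
    inversion H1 as [|? ? ? _ HA _]; subst. apply wfm_vars in HA; auto.
Qed.

Lemma mid_sub_wf D G : wfmctx D -> wfmctx G ->
  (forall x A, mdeclares G x A -> mdeclares D x A) -> wfmsub D (mid_sub G) G.
Proof.
  intros HD HG; induction G as [|G IH x A]; cbn; intros Hi; [constructor; auto|].
  inversion HG; subst. constructor; auto.
  constructor; auto. apply Hi. rewrite msubst_ty_id; auto.
Qed.

Lemma wfm_subst_eq :
  (forall G, wfmctx G -> True) /\
  (forall G A, wfmty G A -> forall D g h, wfmsub D g G -> eqmsub D g h G ->
     eqmty D (msubst_ty A g) (msubst_ty A h)) /\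
  (forall G t A, wfmtm G t A -> forall D g h, wfmsub D g G -> eqmsub D g h G ->
     eqmtm D (msubst_tm t g) (msubst_tm t h) (msubst_ty A g)) /\
  (forall G th T, wfmsub G th T -> forall D g h, wfmsub D g G -> eqmsub D g h G ->
     eqmsub D (msubst_sub th g) (msubst_sub th h) T) /\
  (forall G A B, eqmty G A B -> True) /\
  (forall G t u A, eqmtm G t u A -> True) /\
  (forall D g h G, eqmsub D g h G -> True).
Proof.
  apply wfm_mutind; cbn; intros; auto.
  - apply eqmty_refl; constructor. apply wfm_ctx in H1; tauto.
  - apply eqmty_hom; auto.
  - eapply mlookup_eq; eauto.
  - apply eqmtm_refl; constructor. apply wfm_ctx in H1; tauto.
  - rewrite msubst_ty_comp; [apply eqmtm_mop; auto|].
    erewrite wfmsub_names by eauto. apply op_type_mvars; auto.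
  - rewrite msubst_ty_comp; [apply eqmtm_mcoh; auto|].
    erewrite wfmsub_names by eauto. apply coh_type_mvars; auto.
  - eapply eqmtm_conv; eauto. eapply wfm_subst; eauto.
  - constructor. apply wfm_ctx in H1; tauto.
  - constructor; auto. rewrite <- msubst_ty_comp; auto.
    erewrite wfmsub_names by eauto.
    inversion H1 as [|? ? ? _ HA _]; subst. apply wfm_vars in HA; auto.
Qed.

Lemma wfm_eq :
  (forall G, wfmctx G -> True) /\
  (forall G A, wfmty G A -> True) /\
  (forall G t A, wfmtm G t A -> True) /\
  (forall D g G, wfmsub D g G -> True) /\
  (forall G A B, eqmty G A B -> wfmty G A /\ wfmty G B) /\
  (forall G t u A, eqmtm G t u A -> wfmtm G t A /\ wfmtm G u A) /\
  (forall D g h G, eqmsub D g h G -> wfmsub D g G /\ wfmsub D h G).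
Proof.
  apply wfm_mutind; cbn; auto; try tauto.
  - intros G A A' t t' u u' E [HA HA'] Et [Ht Ht'] Eu [Hu Hu'].
    split; constructor; auto; eapply wfmtm_conv; eauto.
  - intros G t u A B _ [Ht Hu] E _; split; eapply wfmtm_conv; eauto.
  - intros G t Ht _; split; auto. constructor. apply wfm_ctx in Ht; auto.
  - intros D G A g h HA E [Hg Hh]; split; [constructor; auto|].
    eapply wfmtm_conv; [constructor; eauto|].
    apply eqmty_sym. eapply wfm_subst_eq; eauto.
    apply wf_desusp, op_type_wf; auto.
  - intros D G A g h HA E [Hg Hh]; split; [constructor; auto|].
    eapply wfmtm_conv; [apply wfmtm_mcoh; eauto|].
    apply eqmty_sym. eapply wfm_subst_eq; eauto.
    apply wf_desusp, coh_type_wf; auto.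
  - intros; split; constructor; auto.
  - intros D g h G x A t u E [Hg Hh] HG _ _ [Ht Hu]; split; constructor; auto.
    inversion HG; subst.
    eapply wfmtm_conv; eauto. eapply wfm_subst_eq; eauto.
Qed.

Lemma eqmty_wf G A B : eqmty G A B -> wfmty G A /\ wfmty G B.
Proof. apply wfm_eq. Qed.

Lemma eqmsub_wf D g h G : eqmsub D g h G -> wfmsub D g G /\ wfmsub D h G.
Proof. apply wfm_eq. Qed.

Lemma eqmsub_refl D g G : wfmsub D g G -> eqmsub D g g G.
Proof. induction 1; constructor; auto. apply eqmtm_refl; auto. Qed.

Lemma eqmsub_sym D g h G : eqmsub D g h G -> eqmsub D h g G.
Proof.
  induction 1 as [|D g h G x A t u E IH HG Et]; constructor; auto.
  inversion HG; subst. apply eqmsub_wf in E as E'.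
  apply eqmtm_sym. eapply eqmtm_conv; eauto.
  eapply wfm_subst_eq; eauto; apply E'.
Qed.

Lemma eqmsub_trans D g h k G :
  eqmsub D g h G -> eqmsub D h k G -> eqmsub D g k G.
Proof.
  intros E; revert k; induction E as [|D g h G x A t u E IH HG Et];
    intros k F; inversion F; subst; constructor; auto.
  inversion HG; subst. apply eqmsub_wf in E as E'.
  eapply eqmtm_trans; eauto. eapply eqmtm_conv; eauto.
  apply eqmty_sym. eapply wfm_subst_eq; eauto; apply E'.
Qed.

Lemma msubst_sub_eq D G T g h th th' :
  eqmsub G th th' T -> eqmsub D g h G ->
  eqmsub D (msubst_sub th g) (msubst_sub th' h) T.
Proof.
  intros E F. apply eqmsub_wf in E as E', F as F'.
  apply eqmsub_trans with (msubst_sub th' g).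
  - eapply wfm_subst; eauto; apply F'.
  - eapply wfm_subst_eq; eauto; [apply E'|apply F'].
Qed.

Lemma eqmctx_names G G' : eqmctx G G' -> mcnames G = mcnames G'.
Proof. induction 1; cbn; congruence. Qed.

Lemma mid_sub_names G G' : mcnames G = mcnames G' -> mid_sub G = mid_sub G'.
Proof.
  revert G'; induction G; intros []; cbn; try congruence.
  intros [= -> E]. f_equal; auto.
Qed.

Lemma weaken_sub D x A g G :
  wfmctx (mcsnoc D x A) -> wfmsub D g G -> wfmsub (mcsnoc D x A) g G.
Proof.
  intros HD Hg. rewrite <- (proj2 (msubst_id D) g).
  eapply wfm_subst; eauto. inversion HD; subst. apply mid_sub_wf; cbn; auto.
Qed.

Lemma weaken_eqmty D x A B C :
  wfmctx (mcsnoc D x A) -> eqmty D B C -> eqmty (mcsnoc D x A) B C.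
Proof.
  intros HD E. rewrite <- (msubst_ty_id D B), <- (msubst_ty_id D C).
  eapply wfm_subst; eauto. inversion HD; subst. apply mid_sub_wf; cbn; auto.
Qed.

Lemma eqmctx_sub G G' : eqmctx G G' ->
  wfmctx G /\ wfmctx G' /\ wfmsub G' (mid_sub G) G /\ wfmsub G (mid_sub G') G'.
Proof.
  induction 1 as [|G G' x A A' E (HG & HG' & HI & HI') EA Hx Hx'].
  - repeat split; repeat constructor.
  - destruct (eqmty_wf _ _ _ EA) as [HA HA'].
    assert (EA' : eqmty G' A A').
    { rewrite <- (msubst_ty_id G A), <- (msubst_ty_id G A').
      eapply wfm_subst; eauto. }
    destruct (eqmty_wf _ _ _ EA') as [_ HA''].
    assert (H : wfmctx (mcsnoc G x A)) by (constructor; auto).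
    assert (H' : wfmctx (mcsnoc G' x A')) by (constructor; auto).
    repeat split; auto; cbn; constructor; auto using weaken_sub;
      rewrite msubst_ty_id;
      (eapply wfmtm_conv; [apply wfmtm_var; cbn; auto|]);
      apply weaken_eqmty; auto using eqmty_sym.
Qed.

Lemma eqmsub_conv D D' G G' g h :
  eqmctx D D' -> eqmctx G G' -> eqmsub D g h G -> eqmsub D' g h G'.
Proof.
  intros (_ & _ & HD & _)%eqmctx_sub EG E.
  destruct (eqmsub_names _ _ _ _ E) as [Ng Nh].
  rewrite (eqmctx_names _ _ EG) in Ng, Nh.
  apply eqmctx_sub in EG as (_ & HG' & _ & HI).
  rewrite <- (msubst_id_sub G' g), <- (msubst_id_sub G' h),
    <- (proj2 (msubst_id D) g), <- (proj2 (msubst_id D) h)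
    by auto using wfmctx_nodup.
  eapply msubst_sub_eq; [eauto using eqmsub_refl|].
  eapply wfm_subst; eauto.
Qed.

Lemma eqmctx_refl G : wfmctx G -> eqmctx G G.
Proof.
  induction G; intros H; inversion H; subst; constructor; auto.
  apply eqmty_refl; auto.
Qed.

Lemma eqmty_conv G G' A B : eqmctx G G' -> eqmty G A B -> eqmty G' A B.
Proof.
  intros (_ & _ & HG & _)%eqmctx_sub E.
  rewrite <- (msubst_ty_id G A), <- (msubst_ty_id G B).
  eapply wfm_subst; eauto.
Qed.

Lemma eqmctx_sym G G' : eqmctx G G' -> eqmctx G' G.
Proof.
  induction 1; constructor; auto.
  apply eqmty_sym. eapply eqmty_conv; eauto.
Qed.

Lemma eqmctx_trans G G' G'' : eqmctx G G' -> eqmctx G' G'' -> eqmctx G G''.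
Proof.
  intros E; revert G''; induction E; intros K F; inversion F; subst;
    constructor; auto.
  eapply eqmty_trans; eauto. eapply eqmty_conv; eauto using eqmctx_sym.
Qed.

(** An object of [SynMCaTT] is an equivalence class of derivable contexts, and
    a morphism is an equivalence class of derivable substitutions, for
    definitional equality. Classes are represented as predicates. *)
Record mctx_class : Type := {
  in_ctx_class :> mctx -> Prop;
  ctx_class_ok : exists G, wfmctx G /\ forall G', in_ctx_class G' <-> eqmctx G G' }.

Record msub_class (X Y : mctx_class) : Type := {
  in_sub_class :> msub -> Prop;
  sub_class_ok : exists D G g, X D /\ Y G /\ wfmsub D g G /\
    forall h, in_sub_class h <-> eqmsub D g h G }.

Arguments in_sub_class {X Y} _ _.
Arguments sub_class_ok {X Y} _.

Lemma msub_class_eq X Y (f g : msub_class X Y) : (forall s, f s <-> g s) -> f = g.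
Proof.
  destruct f as [f Hf], g as [g Hg]; cbn; intros E.
  assert (f = g) as ->.
  { apply functional_extensionality; intros s; apply propositional_extensionality; auto. }
  f_equal; apply proof_irrelevance.
Qed.

Lemma ctx_class_inhabited (X : mctx_class) : exists G, X G.
Proof.
  destruct (ctx_class_ok X) as (G & HG & E). exists G. apply E, eqmctx_refl, HG.
Qed.

Lemma ctx_class_eq (X : mctx_class) G G' : X G -> (X G' <-> eqmctx G G').
Proof.
  destruct (ctx_class_ok X) as (K & HK & E). rewrite !E. intros F.
  split; eauto using eqmctx_trans, eqmctx_sym.
Qed.

Lemma sub_class_inhabited X Y (f : msub_class X Y) : exists g, f g.
Proof.
  destruct (sub_class_ok f) as (D & G & g & _ & _ & Hg & E).
  exists g. apply E, eqmsub_refl, Hg.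
Qed.

Lemma sub_class_eq X Y (f : msub_class X Y) D G g h :
  X D -> Y G -> f g -> (f h <-> eqmsub D g h G).
Proof.
  destruct (sub_class_ok f) as (D' & G' & k & HD' & HG' & Hk & E).
  intros HD HG. rewrite !E. intros F.
  apply (ctx_class_eq X _ _ HD') in HD. apply (ctx_class_eq Y _ _ HG') in HG.
  split; intros F'.
  - eapply eqmsub_conv; eauto. eauto using eqmsub_trans, eqmsub_sym.
  - eapply eqmsub_trans; [exact F|].
    eapply eqmsub_conv; eauto using eqmctx_sym.
Qed.

Lemma sub_class_wf X Y (f : msub_class X Y) D G g :
  X D -> Y G -> f g -> wfmsub D g G.
Proof.
  intros HD HG Hg. apply (eqmsub_wf D g g G).
  apply (sub_class_eq X Y f D G g g); auto.
Qed.

Lemma mid_class_ok (X : mctx_class) : exists D G g, X D /\ X G /\ wfmsub D g G /\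
  forall h, (exists G', X G' /\ eqmsub G' (mid_sub G') h G') <-> eqmsub D g h G.
Proof.
  destruct (ctx_class_inhabited X) as [G HG].
  assert (E : eqmctx G G) by (apply (ctx_class_eq X); auto).
  exists G, G, (mid_sub G). repeat split; auto.
  - apply eqmctx_sub; auto.
  - intros (G' & HG' & F).
    assert (E' : eqmctx G G') by (apply (ctx_class_eq X); auto).
    rewrite (mid_sub_names G G') by (apply eqmctx_names; auto).
    apply eqmctx_sym in E'. eapply eqmsub_conv; eassumption.
  - eauto.
Qed.

Definition mid_class (X : mctx_class) : msub_class X X := {|
  in_sub_class := fun h => exists G, X G /\ eqmsub G (mid_sub G) h G;
  sub_class_ok := mid_class_ok X |}.

Lemma mcomp_class_ok X Y Z (g : msub_class Y Z) (f : msub_class X Y) :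
  exists D G s, X D /\ Z G /\ wfmsub D s G /\
  forall h, (exists D' G' t u, X D' /\ Z G' /\ g t /\ f u /\
               eqmsub D' (msubst_sub t u) h G') <-> eqmsub D s h G.
Proof.
  destruct (ctx_class_inhabited X) as [D HD], (ctx_class_inhabited Y) as [K HK],
    (ctx_class_inhabited Z) as [G HG], (sub_class_inhabited _ _ g) as [t Ht],
    (sub_class_inhabited _ _ f) as [u Hu].
  exists D, G, (msubst_sub t u). repeat split; auto.
  - eapply wfm_subst; eauto using sub_class_wf.
  - intros (D' & G' & t' & u' & HD' & HG' & Ht' & Hu' & E).
    apply eqmsub_trans with (msubst_sub t' u').
    + eapply msubst_sub_eq; [apply (sub_class_eq _ _ g K G)|apply (sub_class_eq _ _ f D K)]; auto.
    + apply (eqmsub_conv D' D G' G); auto; [apply (ctx_class_eq X)|apply (ctx_class_eq Z)]; auto.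
  - intros E. exists D, G, t, u; auto.
Qed.

Definition mcomp_class X Y Z (g : msub_class Y Z) (f : msub_class X Y) :
    msub_class X Z := {|
  in_sub_class := fun h => exists D G t u, X D /\ Z G /\ g t /\ f u /\
    eqmsub D (msubst_sub t u) h G;
  sub_class_ok := mcomp_class_ok X Y Z g f |}.

Lemma mcomp_class_in X Y Z (g : msub_class Y Z) (f : msub_class X Y) t u :
  g t -> f u -> mcomp_class X Y Z g f (msubst_sub t u).
Proof.
  intros Ht Hu.
  destruct (ctx_class_inhabited X) as [D HD], (ctx_class_inhabited Y) as [K HK],
    (ctx_class_inhabited Z) as [G HG].
  exists D, G, t, u. repeat split; auto.
  apply eqmsub_refl. eapply wfm_subst; eauto using sub_class_wf.
Qed.

Lemma mid_class_in (X : mctx_class) G : X G -> mid_class X (mid_sub G).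
Proof.
  intros HG. exists G; split; auto. apply eqmsub_refl, eqmctx_sub.
  apply (ctx_class_eq X); auto.
Qed.

Lemma msub_class_meet X Y (f g : msub_class X Y) s : f s -> g s -> f = g.
Proof.
  intros Hf Hg. destruct (ctx_class_inhabited X) as [D HD],
    (ctx_class_inhabited Y) as [G HG].
  apply msub_class_eq; intros h.
  rewrite (sub_class_eq X Y f D G s h), (sub_class_eq X Y g D G s h); auto. tauto.
Qed.

Program Definition SynMCaTT : category := {|
  ob := mctx_class;
  hom := msub_class;
  idm := mid_class;
  compose := mcomp_class |}.
Next Obligation.
  destruct (ctx_class_inhabited X) as [D HD], (ctx_class_inhabited Y) as [G HG],
    (sub_class_inhabited _ _ f) as [s Hs].
  apply msub_class_meet with s; auto.
  assert (H := sub_class_wf _ _ _ _ _ _ HD HG Hs).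
  rewrite <- (msubst_id_sub G s).
  - apply mcomp_class_in; auto using mid_class_in.
  - apply wfmctx_nodup. apply wfm_ctx in H; tauto.
  - eapply wfmsub_names; eauto.
Qed.
Next Obligation.
  destruct (ctx_class_inhabited X) as [D HD], (sub_class_inhabited _ _ f) as [s Hs].
  apply msub_class_meet with s; auto.
  rewrite <- (proj2 (msubst_id D) s).
  apply mcomp_class_in; auto using mid_class_in.
Qed.
Next Obligation.
  destruct (ctx_class_inhabited Y) as [K HK], (ctx_class_inhabited Z) as [L HL],
    (ctx_class_inhabited W) as [M HM], (sub_class_inhabited _ _ f) as [s Hs],
    (sub_class_inhabited _ _ g) as [t Ht], (sub_class_inhabited _ _ h) as [u Hu].
  apply msub_class_meet with (msubst_sub u (msubst_sub t s)).
  - auto using mcomp_class_in.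
  - rewrite <- (proj2 (msubst_comp t s)); auto using mcomp_class_in.
    rewrite (wfmsub_names K t L) by eauto using sub_class_wf.
    assert (H := sub_class_wf _ _ _ _ _ _ HL HM Hu).
    apply wfm_vars in H; auto.
Qed.

(** Classes of MCaTT expressions are related to raw syntax through their
    representatives. *)
Definition is_desuspension (D : functor SynCaTT SynMCaTT) : Prop :=
  (forall G : SynCaTT, in_ctx_class (D G) (desusp_ctx (proj1_sig G))) /\
  (forall (G H : SynCaTT) (g : hom G H),
     in_sub_class (fmap D g) (desusp_sub (proj1_sig g))).

(** The reduced suspension is computed on normal representatives: the
    existence of such a representative is part of the definition, and the
    result is the same for all of them. *)
Definition is_reduced_suspension (S : functor SynMCaTT SynCaTT) : Prop :=
  (forall X : SynMCaTT,
     (exists G, in_ctx_class X G /\ normal_ctx G) /\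
     (forall G, in_ctx_class X G -> normal_ctx G ->
        proj1_sig (S X) = rsusp_ctx G)) /\
  (forall (X Y : SynMCaTT) (f : hom X Y) (D G : mctx),
     in_ctx_class X D -> normal_ctx D -> in_ctx_class Y G -> normal_ctx G ->
     (exists g, in_sub_class f g /\ normal_sub D g) /\
     (forall g, in_sub_class f g -> normal_sub D g ->
        proj1_sig (fmap S f) = rsusp_sub g G)).

(* Main.v *)
From Stdlib Require Import List Arith ClassicalEpsilon.
Require Import Defs.
Import ListNotations.

(** In MCaTT operations and coherences never have type [MUnit], so normalising is
    substituting [Mtt] for the variables of type [MUnit] ([norm_sub]), and
    definitionally equal expressions have syntactically equal normal forms.
    Composed with normalisation, the reduced suspension is invariant under
    definitional equality and commutes with substitution. Up to normalisation,
    desuspending a reduced suspension only renames [x] to [S x] and [Mtt] to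
    [bullet]; undoing the renaming is the substitution [unit_sub], whose inverse
    is [unit_inv]. *)

(** * Normal forms for the eta-rule *)

Fixpoint norm_sub (G : mctx) : msub :=
  match G with
  | mcnil => msnil
  | mcsnoc G x MUnit => mssnoc (norm_sub G) x Mtt
  | mcsnoc G x (MHom _ _ _) => mssnoc (norm_sub G) x (MVar x)
  end.

Notation nf_tm G t := (msubst_tm t (norm_sub G)).
Notation nf_ty G A := (msubst_ty A (norm_sub G)).
Notation nf_sub G g := (msubst_sub g (norm_sub G)).

Fixpoint nf_ctx (G : mctx) : mctx :=
  match G with
  | mcnil => mcnil
  | mcsnoc G x A => mcsnoc (nf_ctx G) x (nf_ty G A)
  end.

Lemma norm_lookup_cases G x :
  mlookup (norm_sub G) x = Mtt \/ mlookup (norm_sub G) x = MVar x.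
Proof.
  induction G as [|G IH y [|]]; cbn; auto;
    destruct (Nat.eqb_spec x y); subst; auto.
Qed.

Lemma norm_lookup G x A : NoDup (mcnames G) -> mdeclares G x A ->
  mlookup (norm_sub G) x = match A with MUnit => Mtt | MHom _ _ _ => MVar x end.
Proof.
  induction G as [|G IH y B]; cbn; [tauto|]. intros N H.
  inversion N as [|? ? Hy N']; subst.
  destruct B; cbn; destruct (Nat.eqb_spec x y) as [->|E];
    destruct H as [[? ->]|H]; auto; try congruence;
    apply mdeclares_name in H; tauto.
Qed.

Lemma norm_names G : msnames (norm_sub G) = mcnames G.
Proof. induction G as [|G IH x []]; cbn; congruence. Qed.

Lemma norm_vars G : incl (mvars_sub (norm_sub G)) (mcnames G).
Proof.
  induction G as [|G IH x []]; cbn; intros y; rewrite ?in_app_iff; cbn;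
    intuition auto.
Qed.

Lemma nf_idem G :
  (forall t, nf_tm G (nf_tm G t) = nf_tm G t) /\
  (forall g, nf_sub G (nf_sub G g) = nf_sub G g).
Proof.
  apply mtm_msub_mutind; cbn; intros; f_equal; auto.
  destruct (norm_lookup_cases G n) as [E|E]; rewrite E; auto.
Qed.

Lemma nf_ty_idem G A : nf_ty G (nf_ty G A) = nf_ty G A.
Proof. induction A; cbn; f_equal; auto; apply nf_idem. Qed.

Lemma norm_nf_ctx G : norm_sub (nf_ctx G) = norm_sub G.
Proof. induction G as [|G IH x []]; cbn; congruence. Qed.

Lemma nf_ctx_names G : mcnames (nf_ctx G) = mcnames G.
Proof. induction G; cbn; congruence. Qed.

Lemma msubst_ty_unit A g : msubst_ty A g = MUnit -> A = MUnit.
Proof. destruct A; cbn; congruence. Qed.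

Lemma desusp_ty_unit A : desusp_ty A = MUnit -> A = Star.
Proof. destruct A; cbn; congruence. Qed.

Lemma op_type_not_star G A : op_type G A -> A <> Star.
Proof. intros []; congruence. Qed.

(** A ps-context declares a variable, and a coherence type must mention every variable of its
    context, whereas [Star] mentions none. *)
Lemma coh_type_not_star G A : coh_type G A -> A <> Star.
Proof.
  intros [G' A' [x H] _ E] ->. apply ps_wf in H as (_ & H & _).
  apply declares_name, E in H. destruct H.
Qed.

Lemma eqmty_unit G A B : eqmty G A B -> A = MUnit <-> B = MUnit.
Proof. induction 1; try tauto. split; congruence. Qed.

(** Operation and coherence types are never [Star], so their desuspensions are never [MUnit], and
    conversion cannot turn an [MHom] into [MUnit]. Only [Mtt] and variables remain, and [norm_sub]
    sends these variables to [Mtt]. *)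
Lemma nf_unit G t : wfmtm G t MUnit -> nf_tm G t = Mtt.
Proof.
  intros H. remember MUnit as A eqn:E. revert E.
  induction H; cbn; intros E; subst; auto.
  - apply wfmctx_nodup in H. rewrite (norm_lookup _ _ _ H H0); auto.
  - apply msubst_ty_unit, desusp_ty_unit in E.
    apply op_type_not_star in H; tauto.
  - apply msubst_ty_unit, desusp_ty_unit in E.
    apply coh_type_not_star in H; tauto.
  - apply IHwfmtm. eapply eqmty_unit; eauto.
Qed.

(** The eta-rule is [nf_unit]; the other rules are equivalence, congruence and conversion rules,
    which a substitution respects. *)
Lemma nf_complete :
  (forall G, wfmctx G -> True) /\
  (forall G A, wfmty G A -> True) /\
  (forall G t A, wfmtm G t A -> True) /\
  (forall D g G, wfmsub D g G -> True) /\
  (forall G A B, eqmty G A B -> nf_ty G A = nf_ty G B) /\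
  (forall G t u A, eqmtm G t u A -> nf_tm G t = nf_tm G u) /\
  (forall D g h G, eqmsub D g h G -> nf_sub D g = nf_sub D h).
Proof.
  apply wfm_mutind; cbn; intros; auto using nf_unit; congruence.
Qed.

Lemma nf_ty_complete G A B : eqmty G A B -> nf_ty G A = nf_ty G B.
Proof. apply nf_complete. Qed.

Lemma nf_sub_complete D g h G : eqmsub D g h G -> nf_sub D g = nf_sub D h.
Proof. apply nf_complete. Qed.

(** [norm_sub] only reads which types are [MUnit], and definitional equality never identifies
    [MUnit] with an [MHom]. *)
Lemma nf_ctx_complete G G' : eqmctx G G' ->
  nf_ctx G = nf_ctx G' /\ norm_sub G = norm_sub G'.
Proof.
  induction 1 as [|G G' x A A' E [E1 E2] EA _ _]; cbn; auto.
  apply nf_ty_complete in EA as EN. apply eqmty_unit in EA.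
  split; [congruence|]. rewrite E2.
  destruct A, A'; auto; [destruct EA as [EA _]|destruct EA as [_ EA]];
    specialize (EA eq_refl); discriminate.
Qed.

(** By eta, normalising is definitionally the identity substitution. Soundness of normal forms then
    follows from the congruence [wfm_subst_eq]. *)
Lemma norm_sub_eq G : wfmctx G -> eqmsub G (mid_sub G) (norm_sub G) G.
Proof.
  induction G as [|G IH x A]; intros HG; [repeat constructor|].
  inversion HG as [|? ? ? HG' HA Hx]; subst.
  assert (HI : wfmsub (mcsnoc G x A) (mid_sub G) G)
    by (apply mid_sub_wf; cbn; auto).
  assert (E : eqmsub (mcsnoc G x A) (mid_sub G) (norm_sub G) G).
  { rewrite <- (proj2 (msubst_id G) (mid_sub G)),
      <- (proj2 (msubst_id G) (norm_sub G)).
    eapply wfm_subst; eauto. }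
  assert (Hv : wfmtm (mcsnoc G x A) (MVar x) A) by (constructor; cbn; auto).
  destruct A; cbn; constructor; auto.
  - apply eqmtm_eta; auto.
  - rewrite msubst_ty_id. apply eqmtm_refl; auto.
Qed.

Lemma nf_ty_sound G A : wfmty G A -> eqmty G A (nf_ty G A).
Proof.
  intros HA. assert (HG : wfmctx G) by (apply wfm_ctx in HA; auto).
  rewrite <- (msubst_ty_id G A) at 1.
  apply norm_sub_eq in HG as E. eapply wfm_subst_eq; eauto.
  apply eqmsub_wf in E; tauto.
Qed.

Lemma nf_sub_sound D g G : wfmsub D g G -> eqmsub D g (nf_sub D g) G.
Proof.
  intros Hg. assert (HD : wfmctx D) by (apply wfm_ctx in Hg; tauto).
  rewrite <- (proj2 (msubst_id D) g) at 1.
  apply norm_sub_eq in HD as E. eapply wfm_subst_eq; eauto.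
  apply eqmsub_wf in E; tauto.
Qed.

Lemma nf_ctx_sound G : wfmctx G -> eqmctx G (nf_ctx G).
Proof.
  induction G; intros H; inversion H; subst; constructor; auto.
  - apply nf_ty_sound; auto.
  - rewrite nf_ctx_names; auto.
Qed.

Lemma nf_normal G :
  (forall t, nf_tm G t = t -> normal_tm G t) /\
  (forall g, nf_sub G g = g -> normal_sub G g).
Proof.
  assert (Hu : forall t, nf_tm G t = t -> wfmtm G t MUnit -> t = Mtt).
  { intros t E <-%nf_unit; auto. }
  apply mtm_msub_mutind; cbn; intros; auto; split; auto; try (apply Hu; cbn; auto; fail);
    try apply H; try apply H0; congruence.
Qed.

Lemma nf_normal_ty G A : nf_ty G A = A -> normal_ty G A.
Proof.
  induction A; cbn; intros; auto.
  split; [|split]; [apply IHA|apply nf_normal|apply nf_normal]; congruence.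
Qed.

Lemma nf_normal_ctx G : normal_ctx (nf_ctx G).
Proof.
  induction G; cbn; auto. split; auto.
  apply nf_normal_ty. rewrite norm_nf_ctx. apply nf_ty_idem.
Qed.

(** Together with [nf_normal], this matches the typing-based [normal_tm] with being fixed by
    [norm_sub]. The inclusion makes every variable declared, hence typable, so normality rules out
    variables of type [MUnit]. *)
Lemma normal_nf G : wfmctx G ->
  (forall t, incl (mvars_tm t) (mcnames G) -> normal_tm G t -> nf_tm G t = t) /\
  (forall g, incl (mvars_sub g) (mcnames G) -> normal_sub G g -> nf_sub G g = g).
Proof.
  intros HG. apply mtm_msub_mutind; cbn; try (intros; f_equal; tauto).
  - intros x Hx [Hn _].
    assert (exists A, mdeclares G x A) as [A HA].
    { assert (Hi : In x (mcnames G)) by (apply Hx; cbn; auto).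
      revert Hi. clear. induction G as [|G IH y B]; cbn; [tauto|].
      intros [->|[A H]%IH]; eauto. }
    rewrite (norm_lookup _ _ _ (wfmctx_nodup _ HG) HA). destruct A; auto.
    symmetry; apply Hn. constructor; auto.
  - intros g Hg x t Ht Hi [Hn Hn']. f_equal; [apply Hg|apply Ht]; auto;
      intros z Hz; apply Hi, in_or_app; auto.
Qed.

Lemma normal_nf_ty G A : wfmty G A -> normal_ty G A -> nf_ty G A = A.
Proof.
  intros HA. assert (HG : wfmctx G) by (apply wfm_ctx in HA; auto).
  apply wfm_vars in HA. revert HA.
  induction A; cbn; intros Hi Hn; auto.
  f_equal; [apply IHA|apply normal_nf|apply normal_nf]; try tauto;
    intros z Hz; apply Hi; rewrite !in_app_iff; auto.
Qed.

Lemma normal_nf_ctx G : wfmctx G -> normal_ctx G -> nf_ctx G = G.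
Proof.
  induction G; cbn; intros HG Hn; auto. inversion HG; subst.
  f_equal; [apply IHG|apply normal_nf_ty]; tauto.
Qed.

Lemma normal_nf_sub D g G : wfmsub D g G -> normal_sub D g -> nf_sub D g = g.
Proof.
  intros Hg. apply normal_nf; [apply wfm_ctx in Hg; tauto|].
  apply wfm_vars in Hg; auto.
Qed.

(** At a variable of type [MUnit], the component of [nf_sub D g] is already [Mtt], so normalising
    over [G] changes nothing. *)
Lemma norm_sub_nf D g G : wfmsub D g G ->
  msubst_sub (norm_sub G) (nf_sub D g) = nf_sub D g.
Proof.
  induction 1 as [|D g G x A t Hg IH HG Ht]; cbn; auto.
  inversion HG as [|? ? ? _ _ Hx]; subst.
  assert (E : msubst_sub (norm_sub G) (mssnoc (nf_sub D g) x (nf_tm D t)) = nf_sub D g).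
  { rewrite (proj2 (msubst_skip _ _ _)); auto.
    intros Hi; apply Hx, norm_vars, Hi. }
  destruct A; cbn; rewrite E, ?Nat.eqb_refl; auto.
  rewrite (nf_unit D t); auto.
Qed.

(** * Suspension of normal forms *)

Notation rs_tm G t := (rsusp_tm (nf_tm G t)).
Notation rs_ty G A := (rsusp_ty (nf_ty G A)).
Notation rs_sub D g G := (rsusp_sub (nf_sub D g) G).
Notation rs_ctx G := (rsusp_ctx (nf_ctx G)).

(** [rsusp_sub] reads from its target context only which types are [MUnit], and normalisation
    preserves this. *)
Lemma rsusp_sub_nf_ctx g G : rsusp_sub g (nf_ctx G) = rsusp_sub g G.
Proof.
  revert g; induction G as [|G IH x []]; intros []; cbn; auto. f_equal; auto.
Qed.

Lemma rs_ctx_names G : cnames (rs_ctx G) = cnames (rsusp_ctx G).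
Proof. induction G as [|G IH x []]; cbn; congruence. Qed.

Lemma rsusp_sub_names g G : msnames g = mcnames G ->
  snames (rsusp_sub g G) = cnames (rsusp_ctx G).
Proof.
  revert g; induction G as [|G IH x []]; intros [|g y t]; cbn; try congruence;
    intros [= -> E]; rewrite ?IH; auto.
Qed.

Lemma rs_sub_names D g G : msnames g = mcnames G ->
  snames (rs_sub D g G) = cnames (rsusp_ctx G).
Proof.
  intros E; apply rsusp_sub_names. rewrite <- E.
  clear; induction g; cbn; congruence.
Qed.

Lemma rsusp_ctx_fresh G x : In (S x) (cnames (rsusp_ctx G)) -> In x (mcnames G).
Proof.
  induction G as [|G IH y []]; cbn; [unfold bullet; intuition congruence|auto|].
  intros [[=]|]; auto.
Qed.

Lemma rs_ctx_fresh G x : In (S x) (cnames (rs_ctx G)) -> In x (mcnames G).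
Proof. rewrite rs_ctx_names; apply rsusp_ctx_fresh. Qed.

Lemma bullet_vars T : incl (vars_sub (bullet_sub T)) (cnames (rsusp_ctx (desusp_ctx T))).
Proof.
  assert (Hb : forall G, In bullet (cnames (rsusp_ctx G))).
  { intros G; induction G as [|G IH x []]; cbn; auto. }
  induction T as [|T IH x []]; cbn; intros y; rewrite ?in_app_iff; cbn; [tauto| |].
  - intros [Hy|[<-|[]]]; auto.
  - intros [Hy|[<-|[]]]; auto.
Qed.

Lemma bullet_names T : snames (bullet_sub T) = cnames T.
Proof. induction T as [|T IH x []]; cbn; congruence. Qed.

Lemma bullet_skip T x t s : ~ In x (cnames T) ->
  subst_sub (bullet_sub T) (ssnoc s (S x) t) = subst_sub (bullet_sub T) s.
Proof.
  intros Hx. apply subst_skip. intros H%bullet_vars%rsusp_ctx_fresh.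
  rewrite desusp_names in H; auto.
Qed.

Lemma rsusp_lookup_bullet g G : lookup (rsusp_sub g G) bullet = Var bullet.
Proof.
  revert g; induction G as [|G IH x []]; intros [|g y t]; cbn; auto.
Qed.

Lemma rs_lookup D g G x A t u : NoDup (mcnames G) -> msnames g = mcnames G ->
  mdeclares G x (MHom A t u) ->
  lookup (rs_sub D g G) (S x) = rs_tm D (mlookup g x).
Proof.
  revert g; induction G as [|G IH y B]; intros [|g z v]; cbn; try tauto;
    try discriminate.
  intros N [= -> E] H. inversion N as [|? ? Hy N']; subst.
  destruct (Nat.eqb_spec x y) as [->|F].
  - destruct H as [[_ <-]|H%mdeclares_name]; [|tauto].
    cbn. rewrite Nat.eqb_refl; auto.
  - destruct H as [[-> _]|H]; [tauto|].
    destruct B; cbn; [apply IH; auto|].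
    destruct (Nat.eqb_spec x y); [tauto|apply IH; auto].
Qed.

(** Functoriality of suspension. A variable of type [MUnit] is erased from the suspended context,
    but both sides send it to [bullet]. For operations and coherences, the inserted [bullet_sub]
    only calls for associativity of composition. *)
Lemma rs_subst :
  (forall G, wfmctx G -> True) /\
  (forall G A, wfmty G A -> forall D g, wfmsub D g G ->
     rs_ty D (msubst_ty A g) = subst_ty (rs_ty G A) (rs_sub D g G)) /\
  (forall G t A, wfmtm G t A -> forall D g, wfmsub D g G ->
     rs_tm D (msubst_tm t g) = subst_tm (rs_tm G t) (rs_sub D g G)) /\
  (forall G th T, wfmsub G th T -> forall D g, wfmsub D g G ->
     rs_sub D (msubst_sub th g) T = subst_sub (rs_sub G th T) (rs_sub D g G)) /\
  (forall G A B, eqmty G A B -> True) /\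
  (forall G t u A, eqmtm G t u A -> True) /\
  (forall D g h G, eqmsub D g h G -> True).
Proof.
  apply wfm_mutind; cbn; intros; auto.
  - f_equal; auto.
  - assert (Hl := mlookup_wf _ _ _ H2 _ _ H1). apply wfmctx_nodup in H.
    rewrite (norm_lookup _ _ _ H H1). destruct A; cbn.
    + rewrite rsusp_lookup_bullet, nf_unit; auto.
    + erewrite rs_lookup; eauto using wfmsub_names.
  - symmetry; apply rsusp_lookup_bullet.
  - f_equal. rewrite H1 by auto. symmetry; apply subst_comp.
    erewrite rs_sub_names by eauto using wfmsub_names. apply bullet_vars.
  - f_equal. rewrite H1 by auto. symmetry; apply subst_comp.
    erewrite rs_sub_names by eauto using wfmsub_names. apply bullet_vars.
  - rewrite rsusp_lookup_bullet; auto.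
  - destruct A; cbn; auto. f_equal; auto.
Qed.

(** * The counit, and typing of suspensions *)

(** The clause on substitutions is naturality of the counit. It is also what the operation and
    coherence cases need, since [rsusp_tm] composes their arguments with [bullet_sub]. *)
Lemma rs_counit :
  (forall G, wfctx G -> True) /\
  (forall G A, wfty G A ->
     rs_ty (desusp_ctx G) (desusp_ty A) = subst_ty A (bullet_sub G)) /\
  (forall G t A, wftm G t A ->
     rs_tm (desusp_ctx G) (desusp_tm t) = subst_tm t (bullet_sub G)) /\
  (forall D g G, wfsub D g G ->
     subst_sub (bullet_sub G) (rs_sub (desusp_ctx D) (desusp_sub g) (desusp_ctx G)) =
     subst_sub g (bullet_sub D)) /\
  (forall G A, op_type G A -> True) /\
  (forall G A, coh_type G A -> True).
Proof.
  apply wf_mutind; cbn; intros; auto; try (f_equal; auto; fail).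
  - assert (N := wfmctx_nodup _ (proj1 wf_desusp _ H)). apply desusp_declares in H1 as Hd.
    rewrite (norm_lookup _ _ _ N Hd).
    apply wfctx_nodup in H. revert H H1. clear.
    induction G as [|G IH y B]; cbn; [tauto|]. intros N H.
    inversion N as [|? ? Hy N']; subst.
    destruct B; cbn; destruct (Nat.eqb_spec x y) as [->|E];
      destruct H as [[? ->]|H]; auto; try congruence;
      apply declares_name in H; tauto.
  - inversion H1 as [|? ? ? _ _ Hx]; subst.
    apply wf_desusp in H3 as Ht. destruct A; cbn; cycle 1.
    + rewrite bullet_skip, Nat.eqb_refl by auto. f_equal; auto.
    + rewrite rsusp_lookup_bullet. f_equal; auto. rewrite <- H4.
      rewrite nf_unit; auto.
Qed.

Lemma wfsub_weaken D x A g G : wfctx (csnoc D x A) -> wfsub D g G ->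
  wfsub (csnoc D x A) g G.
Proof.
  intros HD Hg. rewrite <- (proj2 (subst_id D) g).
  eapply wf_subst; eauto. inversion HD; subst. apply id_sub_wf; cbn; auto.
Qed.

Lemma rs_declares_bullet G : declares (rs_ctx G) bullet Star.
Proof. induction G as [|G IH x []]; cbn; auto. Qed.

(** By [rs_counit], the type of [S x] in the suspended context is [A] pulled back along
    [bullet_sub], so the context and the substitution are shown well formed together. *)
Lemma bullet_wf T : wfctx T ->
  wfctx (rs_ctx (desusp_ctx T)) /\ wfsub (rs_ctx (desusp_ctx T)) (bullet_sub T) T.
Proof.
  induction T as [|T IH x A]; intros HT.
  - cbn. assert (wfctx (csnoc cnil bullet Star)) by (repeat constructor; auto).
    split; auto. constructor; auto.
  - inversion HT as [|? ? ? HT' HA Hx]; subst. destruct IH as [HC HB]; auto.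
    destruct A as [|A t u].
    + cbn. split; auto. repeat constructor; auto using rs_declares_bullet.
    + assert (E := proj1 (proj2 rs_counit) _ _ HA).
      assert (HC' : wfctx (rs_ctx (desusp_ctx (csnoc T x (Hom A t u))))).
      { cbn in *. rewrite E. constructor; auto.
        - eapply (proj1 (proj2 wf_subst)) in HA; eauto.
        - intros Hi%rs_ctx_fresh. rewrite desusp_names in Hi; auto. }
      split; auto. cbn. constructor; auto.
      * apply wfsub_weaken; auto.
      * constructor; auto. left; split; auto.
Qed.

Lemma nf_ty_skip G A x B : ~ In x (mcnames G) -> incl (mvars_ty A) (mcnames G) ->
  nf_ty (mcsnoc G x B) A = nf_ty G A.
Proof. intros Hx Hi. destruct B; cbn; apply msubst_ty_skip; auto. Qed.

Lemma rs_declares G x A : wfmctx G -> mdeclares G x A -> A <> MUnit ->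
  declares (rs_ctx G) (S x) (rs_ty G A).
Proof.
  induction G as [|G IH y B]; intros HG; cbn [mdeclares]; [tauto|].
  inversion HG as [|? ? ? HG' HB Hy]; subst.
  intros [[-> ->]|H] HA.
  - apply wfm_vars in HB. rewrite nf_ty_skip by auto.
    destruct B; [congruence|]. cbn; auto.
  - rewrite nf_ty_skip; eauto.
    + destruct B; cbn; auto.
    + exact (proj1 wfm_vars _ HG' _ _ H).
Qed.

(** Used in the operation and coherence cases of [rs_wf], where it turns the suspended type into the
    one that the typing rule of CaTT produces. *)
Lemma rs_op_type D T A g : wfty T A -> wfmsub D g (desusp_ctx T) ->
  rs_ty D (msubst_ty (desusp_ty A) g) =
  subst_ty A (subst_sub (bullet_sub T) (rs_sub D g (desusp_ctx T))).
Proof.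
  intros HA Hg.
  rewrite (proj1 (proj2 rs_subst) (desusp_ctx T)); auto.
  - rewrite (proj1 (proj2 rs_counit)), subst_ty_comp; auto.
    rewrite bullet_names. apply wf_vars in HA; auto.
  - apply wf_desusp; auto.
Qed.

Lemma rs_wf :
  (forall G, wfmctx G -> wfctx (rs_ctx G)) /\
  (forall G A, wfmty G A -> wfty (rs_ctx G) (rs_ty G A)) /\
  (forall G t A, wfmtm G t A -> wftm (rs_ctx G) (rs_tm G t) (rs_ty G A)) /\
  (forall D g G, wfmsub D g G -> wfsub (rs_ctx D) (rs_sub D g G) (rs_ctx G)) /\
  (forall G A B, eqmty G A B -> True) /\
  (forall G t u A, eqmtm G t u A -> True) /\
  (forall D g h G, eqmsub D g h G -> True).
Proof.
  apply wfm_mutind; cbn; intros; auto.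
  - repeat constructor; auto.
  - destruct A; cbn; auto. constructor; auto.
    intros Hi%rs_ctx_fresh; auto.
  - constructor; auto.
  - constructor; auto.
  - rewrite (norm_lookup _ _ _ (wfmctx_nodup _ H) H1).
    destruct A; cbn; constructor; auto using rs_declares_bullet.
    apply (rs_declares G x (MHom A m m0)); congruence.
  - constructor; auto using rs_declares_bullet.
  - apply op_type_wf in H as HA. rewrite (rs_op_type D G) by auto.
    constructor; auto. eapply wf_subst; eauto.
    apply bullet_wf. apply wf_ctx in HA; auto.
  - apply coh_type_wf in H as HA. rewrite (rs_op_type D G) by auto.
    constructor; auto. eapply wf_subst; eauto.
    apply bullet_wf. apply wf_ctx in HA; auto.
  (* Conversion disappears because definitionally equal types have the same normal form. *)
  - rewrite <- (nf_ty_complete G A B); auto.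
  - assert (wfctx (csnoc cnil bullet Star)) by (repeat constructor; auto).
    constructor; auto; repeat constructor; auto using rs_declares_bullet.
  - inversion H1 as [|? ? ? _ HA Hx]; subst. destruct A; cbn; auto.
    constructor; auto.
    rewrite (proj1 (proj2 rs_subst) _ _ HA) in H4; auto.
Qed.

(** * Unit *)

(** Suspension erases variables of type [MUnit], so they get no component; [bullet] has type [Star],
    which desuspends to [MUnit], whence [Mtt]. *)
Fixpoint unit_sub (G : mctx) : msub :=
  match G with
  | mcnil => mssnoc msnil bullet Mtt
  | mcsnoc G _ MUnit => unit_sub G
  | mcsnoc G x (MHom _ _ _) => mssnoc (unit_sub G) (S x) (MVar x)
  end.

Fixpoint unit_inv (G : mctx) : msub :=
  match G with
  | mcnil => msnil
  | mcsnoc G x MUnit => mssnoc (unit_inv G) x Mtt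
  | mcsnoc G x (MHom _ _ _) => mssnoc (unit_inv G) x (MVar (S x))
  end.

Lemma unit_names G : msnames (unit_sub G) = cnames (rsusp_ctx G).
Proof. induction G as [|G IH x []]; cbn; congruence. Qed.

Lemma unit_vars G : incl (mvars_sub (unit_sub G)) (mcnames G).
Proof.
  induction G as [|G IH x []]; cbn; intros y; rewrite ?in_app_iff; cbn;
    intuition auto.
Qed.

Lemma unit_lookup_bullet G : mlookup (unit_sub G) bullet = Mtt.
Proof. induction G as [|G IH x []]; cbn; auto. Qed.

Lemma unit_lookup G x A t u : mdeclares G x (MHom A t u) ->
  mlookup (unit_sub G) (S x) = MVar x.
Proof.
  induction G as [|G IH y B]; cbn; [tauto|].
  destruct (Nat.eqb_spec x y) as [->|N].
  - intros [[_ <-]|H]; cbn; rewrite ?Nat.eqb_refl; auto.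
    destruct B; cbn; rewrite ?Nat.eqb_refl; auto.
  - intros [[-> _]|H]; [tauto|]. destruct B; cbn; auto.
    destruct (Nat.eqb_spec x y); tauto.
Qed.

Lemma desusp_sub_names g : msnames (desusp_sub g) = snames g.
Proof. induction g; cbn; congruence. Qed.

(** The triangle identity at a desuspended context, on representatives: [norm_sub] stands for the
    identity. *)
Lemma bullet_unit T : wfctx T ->
  msubst_sub (desusp_sub (bullet_sub T)) (unit_sub (desusp_ctx T)) =
  norm_sub (desusp_ctx T).
Proof.
  induction T as [|T IH x A]; cbn; auto. intros HT.
  inversion HT as [|? ? ? HT' _ Hx]; subst.
  destruct A; cbn; rewrite ?unit_lookup_bullet, ?Nat.eqb_refl, <- ?IH; auto.
  f_equal. apply msubst_skip. rewrite (proj2 desusp_vars).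
  intros Hi%bullet_vars%rsusp_ctx_fresh. rewrite desusp_names in Hi; auto.
Qed.

(** Operation and coherence case of [rs_unit], whose induction hypothesis is the last premise. That
    premise moves [unit_sub] past the arguments, [bullet_unit] turns it into [norm_sub], and
    [norm_sub_nf] absorbs the result. *)
Lemma bullet_rs_unit D g T : wfctx T -> wfmsub D g (desusp_ctx T) ->
  msubst_sub (desusp_sub (rs_sub D g (desusp_ctx T))) (unit_sub D) =
    msubst_sub (unit_sub (desusp_ctx T)) (nf_sub D g) ->
  msubst_sub (desusp_sub (subst_sub (bullet_sub T) (rs_sub D g (desusp_ctx T))))
    (unit_sub D) = nf_sub D g.
Proof.
  intros HT Hg E. rewrite (proj2 (desusp_subst _)), (proj2 (msubst_comp _ _)), E.
  - rewrite <- (proj2 (msubst_comp _ _)), bullet_unit; auto.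
    + eapply norm_sub_nf; eauto.
    + rewrite (proj2 desusp_vars), unit_names. apply bullet_vars.
  - rewrite (proj2 desusp_vars), desusp_sub_names.
    erewrite rs_sub_names by eauto using wfmsub_names. apply bullet_vars.
Qed.

(** The clause on substitutions is naturality of the unit; those on types and terms say that
    [unit_sub] undoes the renaming. *)
Lemma rs_unit :
  (forall G, wfmctx G -> True) /\
  (forall G A, wfmty G A ->
     msubst_ty (desusp_ty (rs_ty G A)) (unit_sub G) = nf_ty G A) /\
  (forall G t A, wfmtm G t A ->
     msubst_tm (desusp_tm (rs_tm G t)) (unit_sub G) = nf_tm G t) /\
  (forall D g G, wfmsub D g G ->
     msubst_sub (desusp_sub (rs_sub D g G)) (unit_sub D) =
     msubst_sub (unit_sub G) (nf_sub D g)) /\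
  (forall G A B, eqmty G A B -> True) /\
  (forall G t u A, eqmtm G t u A -> True) /\
  (forall D g h G, eqmsub D g h G -> True).
Proof.
  apply wfm_mutind; cbn; intros; auto.
  - f_equal; auto.
  - rewrite (norm_lookup _ _ _ (wfmctx_nodup _ H) H1).
    destruct A; cbn; [apply unit_lookup_bullet|eapply unit_lookup; eauto].
  - apply unit_lookup_bullet.
  - f_equal. apply bullet_rs_unit; auto.
    apply op_type_wf, wf_ctx in H; auto.
  - f_equal. apply bullet_rs_unit; auto.
    apply coh_type_wf, wf_ctx in H; auto.
  - rewrite unit_lookup_bullet; auto.
  - inversion H1 as [|? ? ? _ _ Hx]; subst.
    assert (E : msubst_sub (unit_sub G) (mssnoc (nf_sub D g) x (nf_tm D t)) =
      msubst_sub (unit_sub G) (nf_sub D g)).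
    { apply msubst_skip. intros Hi. apply Hx, unit_vars, Hi. }
    destruct A; cbn; rewrite E; auto.
    rewrite Nat.eqb_refl. f_equal; auto.
Qed.

Lemma rs_ctx_wf G : wfmctx G -> wfmctx (desusp_ctx (rs_ctx G)).
Proof. intros H. apply wf_desusp, rs_wf, H. Qed.

Lemma unit_wf G : wfmctx G -> wfmsub G (unit_sub G) (desusp_ctx (rs_ctx G)).
Proof.
  induction G as [|G IH x A]; intros HG.
  - cbn. assert (wfmctx (mcsnoc mcnil bullet MUnit)) by (repeat constructor; auto).
    repeat constructor; auto.
  - inversion HG as [|? ? ? HG' HA Hx]; subst. apply rs_ctx_wf in HG as HC.
    assert (E := proj1 (proj2 rs_unit) _ _ HA). apply nf_ty_sound in HA as HE.
    destruct A; [apply weaken_sub; auto|].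
    cbn in *; constructor; auto using weaken_sub.
    (* The expected type is the normal form of the declared one, so a conversion remains. *)
    eapply wfmtm_conv; [constructor; cbn; auto|]. cbn; rewrite E.
    apply weaken_eqmty; auto.
Qed.


(** * The inverse of the unit *)

Lemma unit_inv_vars G : incl (mvars_sub (unit_inv G)) (cnames (rsusp_ctx G)).
Proof.
  induction G as [|G IH x []]; cbn; intros y; rewrite ?in_app_iff; cbn;
    intuition auto.
Qed.

(** Here and in [unit_inv_unit], the composite is syntactically a normalising substitution, which
    represents an identity of [SynMCaTT]. *)
Lemma unit_unit_inv G : NoDup (mcnames G) ->
  msubst_sub (unit_sub G) (unit_inv G) = norm_sub (desusp_ctx (rs_ctx G)).
Proof.
  induction G as [|G IH x A]; cbn; auto. intros N; inversion N; subst.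
  assert (E : forall t, msubst_sub (unit_sub G) (mssnoc (unit_inv G) x t) =
    norm_sub (desusp_ctx (rs_ctx G))).
  { intros t. rewrite <- IH by auto. apply msubst_skip.
    intros Hi%unit_vars; auto. }
  destruct A; cbn; rewrite E, ?Nat.eqb_refl; auto.
Qed.

Lemma unit_inv_unit G : NoDup (mcnames G) ->
  msubst_sub (unit_inv G) (unit_sub G) = norm_sub G.
Proof.
  induction G as [|G IH x A]; cbn; auto. intros N; inversion N; subst.
  destruct A; cbn; rewrite ?Nat.eqb_refl, <- IH; auto.
  f_equal. apply msubst_skip. intros Hi%unit_inv_vars%rsusp_ctx_fresh; auto.
Qed.

Lemma norm_unit_inv G : NoDup (mcnames G) ->
  msubst_sub (norm_sub G) (unit_inv G) = unit_inv G.
Proof.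
  induction G as [|G IH x A]; cbn; auto. intros N; inversion N; subst.
  assert (E : forall t, msubst_sub (norm_sub G) (mssnoc (unit_inv G) x t) =
    unit_inv G).
  { intros t. rewrite <- IH at 2 by auto. apply msubst_skip.
    intros Hi%norm_vars; auto. }
  destruct A; cbn; rewrite E, ?Nat.eqb_refl; auto.
Qed.

(** No new induction: normalisation factors as [unit_sub] followed by [unit_inv], [rs_unit]
    evaluates the first factor, and [norm_unit_inv] absorbs the normalisation left over. *)
Lemma rs_unit_inv G A : wfmty G A ->
  nf_ty (desusp_ctx (rs_ctx G)) (desusp_ty (rs_ty G A)) = msubst_ty A (unit_inv G).
Proof.
  intros HA. assert (N : NoDup (mcnames G)) by (apply wfmctx_nodup; apply wfm_ctx in HA; auto).
  rewrite <- unit_unit_inv, <- msubst_ty_comp, (proj1 (proj2 rs_unit)), msubst_ty_comp,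
    norm_unit_inv; auto.
  - rewrite norm_names. apply wfm_vars in HA; auto.
  - rewrite desusp_vars_ty, unit_names, <- rs_ctx_names.
    apply rs_wf, wf_vars in HA; auto.
Qed.

Lemma unit_inv_wf G : wfmctx G -> wfmsub (desusp_ctx (rs_ctx G)) (unit_inv G) G.
Proof.
  induction G as [|G IH x A]; intros HG.
  - constructor. apply rs_ctx_wf; auto.
  - inversion HG as [|? ? ? HG' HA Hx]; subst. apply rs_ctx_wf in HG as HC.
    assert (E := rs_unit_inv _ _ HA).
    destruct A; cbn in *; constructor; auto using weaken_sub.
    + constructor; auto.
    + eapply wfmtm_conv; [constructor; cbn; auto|].
      apply weaken_eqmty; auto. cbn. rewrite <- E.
      apply (nf_ty_sound _ (desusp_ty (rs_ty G (MHom A m m0)))).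
      apply wf_desusp, rs_wf; auto.
Qed.

Lemma rs_sub_id G : NoDup (mcnames G) -> rs_sub G (mid_sub G) G = id_sub (rs_ctx G).
Proof.
  intros N. rewrite msubst_id_sub; auto using norm_names.
  clear N. induction G as [|G IH x []]; cbn; auto. f_equal; auto.
Qed.

Lemma triangle_rs G : wfmctx G ->
  subst_sub (bullet_sub (rs_ctx G))
    (rs_sub G (unit_sub G) (desusp_ctx (rs_ctx G))) = id_sub (rs_ctx G).
Proof.
  intros HG.
  (* The induction shortens [G] while terms are still normalised in the full context, so the latter
     becomes a separate [D], constrained only on the variables that suspension keeps. *)
  assert (forall D, (forall x A t u, mdeclares G x (MHom A t u) ->
      mlookup (norm_sub D) x = MVar x) ->
    subst_sub (bullet_sub (rs_ctx G))
      (rs_sub D (unit_sub G) (desusp_ctx (rs_ctx G))) = id_sub (rs_ctx G)).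
  { intros D. induction G as [|G IH x A]; cbn; auto. intros HD.
    inversion HG as [|? ? ? HG' _ Hx]; subst.
    destruct A; cbn; [apply IH; eauto|].
    rewrite bullet_skip, IH, Nat.eqb_refl; eauto.
    - f_equal. erewrite HD; eauto.
    - intros H%rs_ctx_fresh; auto. }
  apply H. intros x A t u Hx.
  rewrite (norm_lookup _ _ _ (wfmctx_nodup _ HG) Hx); auto.
Qed.

Lemma unit_sub_nf_ctx G : unit_sub (nf_ctx G) = unit_sub G.
Proof. induction G as [|G IH x []]; cbn; congruence. Qed.

Lemma eqmctx_unit_sub G G' : eqmctx G G' -> unit_sub G = unit_sub G'.
Proof.
  intros [E _]%nf_ctx_complete.
  rewrite <- unit_sub_nf_ctx, E, unit_sub_nf_ctx; auto.
Qed.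

(** * The adjunction *)

Lemma unit_iso_coreflective {C D : category} {L : functor C D} {R : functor D C}
    (adj : adjunction L R) :
  (forall X, is_iso (adj_unit adj X)) -> coreflective adj.
Proof.
  intros H X Y g. destruct (H Y) as (e & E1 & E2).
  (* By the triangle identity, [L] maps the inverse of the unit to the counit. *)
  assert (Ee : fmap L e = adj_counit adj (L Y)).
  { rewrite <- (compose_id_l _ _ _ (fmap L e)), <- (triangle_left _ _ adj Y),
      <- compose_assoc, <- fmap_compose, E2, fmap_id, compose_id_r; auto. }
  (* The adjoint transpose of [g], followed by the inverse of the unit. *)
  exists (compose e (compose (fmap R g) (adj_unit adj X))). split.
  - rewrite !fmap_compose, Ee, compose_assoc, counit_natural, <- compose_assoc,
      triangle_left, compose_id_r; auto.
  - intros f <-. rewrite <- unit_natural, compose_assoc, E1, compose_id_l; auto.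
Qed.

(** * The desuspension functor *)

Program Definition ctx_class G (HG : wfmctx G) : mctx_class :=
  {| in_ctx_class := eqmctx G |}.
Next Obligation. exists G; split; tauto. Qed.

Program Definition sub_class (X Y : mctx_class) D G g
    (HD : X D) (HG : Y G) (Hg : wfmsub D g G) : msub_class X Y :=
  {| in_sub_class := fun h => eqmsub D g h G |}.
Next Obligation. exists D, G, g; tauto. Qed.

Lemma ctx_class_wf (X : mctx_class) G : X G -> wfmctx G.
Proof. intros H. apply (eqmctx_sub G G), (ctx_class_eq X); auto. Qed.

Lemma desusp_id G : desusp_sub (id_sub G) = mid_sub (desusp_ctx G).
Proof. induction G; cbn; congruence. Qed.

Program Definition desusp_functor : functor SynCaTT SynMCaTT := {|
  fob := fun G => ctx_class (desusp_ctx (proj1_sig G)) _;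
  fmap := fun G H g => sub_class _ _ (desusp_ctx (proj1_sig G))
    (desusp_ctx (proj1_sig H)) (desusp_sub (proj1_sig g)) _ _ _ |}.
Next Obligation. apply wf_desusp, (proj2_sig G). Qed.
Next Obligation. apply eqmctx_refl, wf_desusp, (proj2_sig G). Qed.
Next Obligation. apply eqmctx_refl, wf_desusp, (proj2_sig H). Qed.
Next Obligation. apply wf_desusp, (proj2_sig g). Qed.

Next Obligation.
  apply msub_class_meet with (mid_sub (desusp_ctx (proj1_sig X))).
  - cbn. rewrite desusp_id. apply eqmsub_refl, mid_sub_wf; auto;
      apply wf_desusp, (proj2_sig X).
  - apply mid_class_in. cbn. apply eqmctx_refl, wf_desusp, (proj2_sig X).
Qed.
Next Obligation.
  apply msub_class_meet with (desusp_sub (subst_sub (proj1_sig g) (proj1_sig f))).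
  - apply eqmsub_refl, wf_desusp. eapply wf_subst;
      [exact (proj2_sig g)|exact (proj2_sig f)].
  - rewrite (proj2 (desusp_subst _)).
    apply mcomp_class_in; apply eqmsub_refl, wf_desusp;
      [exact (proj2_sig g)|exact (proj2_sig f)].
Qed.

Lemma desusp_ctx_in (G : SynCaTT) :
  in_ctx_class (desusp_functor G) (desusp_ctx (proj1_sig G)).
Proof. apply eqmctx_refl, wf_desusp, (proj2_sig G). Qed.

Lemma desusp_sub_in (G H : SynCaTT) (g : hom G H) :
  in_sub_class (fmap desusp_functor g) (desusp_sub (proj1_sig g)).
Proof. apply eqmsub_refl, wf_desusp, (proj2_sig g). Qed.

(** * The reduced suspension functor *)

(** Classes are predicates while [SynCaTT] consists of raw syntax, so representatives are chosen;
    [rs_ob_eq] and [rs_hom_eq] show that the choice is immaterial. *)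
Definition ctx_repr (X : mctx_class) : mctx :=
  proj1_sig (constructive_indefinite_description _ (ctx_class_inhabited X)).

Lemma ctx_repr_in (X : mctx_class) : X (ctx_repr X).
Proof. unfold ctx_repr; destruct constructive_indefinite_description; auto. Qed.

Definition sub_repr X Y (f : msub_class X Y) : msub :=
  proj1_sig (constructive_indefinite_description _ (sub_class_inhabited X Y f)).

Lemma sub_repr_in X Y (f : msub_class X Y) : f (sub_repr X Y f).
Proof. unfold sub_repr; destruct constructive_indefinite_description; auto. Qed.

Lemma ctx_repr_wf X : wfmctx (ctx_repr X).
Proof. eapply ctx_class_wf, ctx_repr_in. Qed.

Definition rs_ob (X : SynMCaTT) : SynCaTT :=
  exist _ (rs_ctx (ctx_repr X)) (proj1 rs_wf _ (ctx_repr_wf X)).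

Lemma rs_hom_wf (X Y : SynMCaTT) (f : hom X Y) :
  wfsub (rs_ctx (ctx_repr X)) (rs_sub (ctx_repr X) (sub_repr X Y f) (ctx_repr Y))
    (rs_ctx (ctx_repr Y)).
Proof.
  apply rs_wf. eapply sub_class_wf; [apply ctx_repr_in..|apply sub_repr_in].
Qed.

Definition rs_hom (X Y : SynMCaTT) (f : hom X Y) : hom (rs_ob X) (rs_ob Y) :=
  exist _ (rs_sub (ctx_repr X) (sub_repr X Y f) (ctx_repr Y)) (rs_hom_wf X Y f).

Lemma rs_ob_eq (X : mctx_class) G : X G -> proj1_sig (rs_ob X) = rs_ctx G.
Proof.
  intros H. cbn. f_equal. apply nf_ctx_complete, (ctx_class_eq X); auto.
  apply ctx_repr_in.
Qed.

(** Other representatives have the same normal forms and the same [norm_sub]. Later equations can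
    thus be computed on convenient representatives. *)
Lemma rs_hom_eq X Y (f : msub_class X Y) D G g : X D -> Y G -> f g ->
  proj1_sig (rs_hom X Y f) = rs_sub D g G.
Proof.
  intros HD HG Hg. cbn.
  apply (ctx_class_eq X _ _ (ctx_repr_in X)), nf_ctx_complete in HD as [_ <-].
  assert (E : eqmsub (ctx_repr X) (sub_repr X Y f) g (ctx_repr Y)).
  { apply (sub_class_eq X Y f); auto using ctx_repr_in, sub_repr_in. }
  apply nf_sub_complete in E as ->.
  apply (ctx_class_eq Y _ _ (ctx_repr_in Y)), nf_ctx_complete in HG as [E _].
  rewrite <- rsusp_sub_nf_ctx, E, rsusp_sub_nf_ctx; auto.
Qed.

Program Definition rsusp_functor : functor SynMCaTT SynCaTT := {|
  fob := rs_ob; fmap := rs_hom |}.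
Next Obligation.
  apply wf_sub_eq.
  rewrite (rs_hom_eq X X _ (ctx_repr X) (ctx_repr X) (mid_sub (ctx_repr X)));
    auto using ctx_repr_in, mid_class_in.
  apply rs_sub_id, wfmctx_nodup, ctx_repr_wf.
Qed.
Next Obligation.
  apply wf_sub_eq.
  rewrite (rs_hom_eq X Z _ (ctx_repr X) (ctx_repr Z)
    (msubst_sub (sub_repr _ _ g) (sub_repr _ _ f)));
    auto using ctx_repr_in, mcomp_class_in, sub_repr_in.
  cbn. eapply rs_subst; eapply sub_class_wf;
    auto using ctx_repr_in; apply sub_repr_in.
Qed.

(** * Unit, counit and triangle identities *)

Definition unit_class (X : SynMCaTT) : hom X (desusp_functor (rsusp_functor X)) :=
  sub_class _ _ _ _ _ (ctx_repr_in X) (desusp_ctx_in (rsusp_functor X))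
    (unit_wf _ (ctx_repr_wf X)).

Definition unit_inv_class (X : SynMCaTT) : hom (desusp_functor (rsusp_functor X)) X :=
  sub_class _ _ _ _ _ (desusp_ctx_in (rsusp_functor X)) (ctx_repr_in X)
    (unit_inv_wf _ (ctx_repr_wf X)).

Lemma unit_class_in X : in_sub_class (unit_class X) (unit_sub (ctx_repr X)).
Proof. apply eqmsub_refl, unit_wf, ctx_repr_wf. Qed.

Lemma unit_inv_class_in X : in_sub_class (unit_inv_class X) (unit_inv (ctx_repr X)).
Proof. apply eqmsub_refl, unit_inv_wf, ctx_repr_wf. Qed.

Lemma rs_desusp (G : SynCaTT) :
  proj1_sig (rsusp_functor (desusp_functor G)) = rs_ctx (desusp_ctx (proj1_sig G)).
Proof. apply rs_ob_eq, desusp_ctx_in. Qed.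

Lemma counit_wf (G : SynCaTT) :
  wfsub (proj1_sig (rsusp_functor (desusp_functor G))) (bullet_sub (proj1_sig G))
    (proj1_sig G).
Proof. rewrite rs_desusp. apply bullet_wf, (proj2_sig G). Qed.

Definition counit (G : SynCaTT) : hom (rsusp_functor (desusp_functor G)) G :=
  exist _ (bullet_sub (proj1_sig G)) (counit_wf G).

Lemma norm_sub_mid_class (X : mctx_class) G : X G -> mid_class X (norm_sub G).
Proof.
  intros H. exists G; split; auto. apply norm_sub_eq. eapply ctx_class_wf; eauto.
Qed.

Lemma nf_sub_in X Y (f : msub_class X Y) D g : X D -> f g -> f (nf_sub D g).
Proof.
  intros HD Hg. destruct (ctx_class_inhabited Y) as [G HG].
  apply (sub_class_eq X Y f D G g); auto.
  apply nf_sub_sound. eapply sub_class_wf; eauto.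
Qed.

Program Definition rsusp_adjunction : adjunction rsusp_functor desusp_functor :=
  {| adj_unit := unit_class; adj_counit := counit |}.
Next Obligation.
  assert (Hg := sub_repr_in _ _ f). set (g := sub_repr _ _ f) in *.
  assert (Hw : wfmsub (ctx_repr X) g (ctx_repr X')).
  { eapply sub_class_wf; eauto using ctx_repr_in. }
  (* This represents both composites: the first because normalising stays in the class of [f], the
     second by [rs_unit]. *)
  apply msub_class_meet with
    (msubst_sub (unit_sub (ctx_repr X')) (nf_sub (ctx_repr X) g)).
  - apply mcomp_class_in; [apply unit_class_in|].
    apply nf_sub_in; auto using ctx_repr_in.
  - rewrite <- (proj1 (proj2 (proj2 (proj2 rs_unit))) _ _ _ Hw).
    apply mcomp_class_in; [|apply unit_class_in].
    apply (desusp_sub_in _ _ (rs_hom X X' f)).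
Qed.
Next Obligation.
  apply wf_sub_eq.
  (* Exposing [rs_hom] lets [rs_hom_eq] trade the chosen representative for the desuspension of
     [g]. *)
  change (subst_sub (bullet_sub (proj1_sig Y'))
    (proj1_sig (rs_hom _ _ (fmap desusp_functor g))) =
    subst_sub (proj1_sig g) (bullet_sub (proj1_sig Y))).
  rewrite (rs_hom_eq _ _ _ _ _ _ (desusp_ctx_in Y) (desusp_ctx_in Y')
    (desusp_sub_in _ _ g)).
  apply rs_counit, (proj2_sig g).
Qed.
Next Obligation.
  apply wf_sub_eq.
  change (subst_sub (bullet_sub (rs_ctx (ctx_repr X)))
    (proj1_sig (rs_hom _ _ (unit_class X))) = id_sub (rs_ctx (ctx_repr X))).
  rewrite (rs_hom_eq _ _ _ _ _ _ (ctx_repr_in X)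
    (desusp_ctx_in (rsusp_functor X)) (unit_class_in X)).
  apply triangle_rs, ctx_repr_wf.
Qed.
Next Obligation.
  apply msub_class_meet with (norm_sub (desusp_ctx (proj1_sig Y))).
  - rewrite <- bullet_unit by apply (proj2_sig Y).
    (* [bullet_unit] concerns the desuspended context itself, whereas the unit is built on the
       chosen representative of its class. *)
    rewrite (eqmctx_unit_sub _ (ctx_repr (desusp_functor Y)))
      by apply (ctx_repr_in (desusp_functor Y)).
    apply mcomp_class_in; [|apply unit_class_in].
    apply (desusp_sub_in _ _ (counit Y)).
  - apply norm_sub_mid_class, desusp_ctx_in.
Qed.

Lemma unit_class_iso X : is_iso (unit_class X).
Proof.
  assert (N := wfmctx_nodup _ (ctx_repr_wf X)).
  exists (unit_inv_class X). split.
  - apply msub_class_meet with (norm_sub (ctx_repr X)).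
    + rewrite <- unit_inv_unit by auto.
      apply mcomp_class_in; auto using unit_class_in, unit_inv_class_in.
    + apply norm_sub_mid_class, ctx_repr_in.
  - apply msub_class_meet with (norm_sub (desusp_ctx (rs_ctx (ctx_repr X)))).
    + rewrite <- unit_unit_inv by auto.
      apply mcomp_class_in; auto using unit_class_in, unit_inv_class_in.
    + apply norm_sub_mid_class, (desusp_ctx_in (rsusp_functor X)).
Qed.

(** Normalisation fixes normal representatives, so normalising and then suspending agrees with the
    raw clauses; normalising any representative gives existence. *)
Lemma rsusp_functor_spec : is_reduced_suspension rsusp_functor.
Proof.
  split.
  - intros X; split.
    + assert (H := ctx_repr_wf X). exists (nf_ctx (ctx_repr X)).
      split; [|apply nf_normal_ctx].
      apply (ctx_class_eq X (ctx_repr X)); auto using ctx_repr_in, nf_ctx_sound.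
    + intros G HG Hn.
      cbn [fob rsusp_functor]. rewrite (rs_ob_eq _ _ HG).
      rewrite normal_nf_ctx; eauto using ctx_class_wf.
  - intros X Y f D G HD HnD HG HnG. split.
    + exists (nf_sub D (sub_repr _ _ f)). split.
      * apply nf_sub_in; auto using sub_repr_in.
      * apply nf_normal, nf_idem.
    + intros g Hg Hn. transitivity (rs_sub D g G).
      * exact (rs_hom_eq _ _ f _ _ _ HD HG Hg).
      * rewrite (normal_nf_sub D g G); auto. eapply sub_class_wf; eauto.
Qed.

Theorem mainTheorem1 :
  exists (S : functor SynMCaTT SynCaTT) (D : functor SynCaTT SynMCaTT),
    is_reduced_suspension S /\ is_desuspension D /\
    exists adj : adjunction S D,
      (forall G : SynCaTT, proj1_sig (adj_counit adj G) = bullet_sub (proj1_sig G)) /\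
      (forall X : SynMCaTT, is_iso (adj_unit adj X)) /\
      coreflective adj.
Proof.
  exists rsusp_functor, desusp_functor. split; [apply rsusp_functor_spec|].
  split; [split; [apply desusp_ctx_in|apply desusp_sub_in]|].
  exists rsusp_adjunction. split; [reflexivity|].
  split; [apply unit_class_iso|].
  apply unit_iso_coreflective, unit_class_iso.
Qed.
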